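(* Let $p$ be a prime and let $a \ge 1$ be an integer. Suppose that $G$ is an Isaacs group of degree $e = p^a$ that is $p$-closed, let $P$ be the normal Sylow $p$-subgroup of $G$, and let $H$ be a Hall $p$-complement of $G$ of order $e-1$ such that $Z(P)H$ is a two transitive Frobenius group. Then $G$ is nonsolvable if and only if $Z(P)H$ is a nonsolvable two transitive Frobenius group. In this case, $e = p^2$ and one of the following occurs: (1) $p = 11$ and $H \cong \mathrm{SL}_2(5)$; (2) $p = 29$ and $H \cong \mathrm{SL}_2(5) \times Z_7$; (3) $p = 59$ and $H \cong \mathrm{SL}_2(5) \times Z_{29}$.
   Context: All groups are finite. For an integer $e > 1$, a group $G$ is an Isaacs group of degree $e$ if $|G| = e^4 - e^3$ and $d = e^2 - e$ is the degree of some irreducible complex character of $G$ (so that $|G| = d(d+e)$). A group is $p$-closed if it has a normal Sylow $p$-subgroup. A $p$-closed Isaacs group of degree $e = p^a$ has a normal Sylow $p$-subgroup $P$ with $|Z(P)| = e$, $|P:Z(P)| = e^2$ and a Hall $p$-complement $H$ (a subgroup of order coprime to $p$ and of $p$-power index) of order $e-1$ such that $Z(P)H$ is a two transitive Frobenius group. For a nontrivial normal subgroup $A$ and a complement $H$, the group $AH$ is a two transitive Frobenius group (with kernel $A$ and complement $H$) if the conjugation action of $H$ on $A \setminus \{1\}$ is transitive and no nonidentity element of $H$ fixes a nonidentity element of $A$. $Z_n$ denotes the cyclic group of order $n$. *)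

(* Defs.v *)
From mathcomp Require Import all_boot all_order all_fingroup all_algebra.
From mathcomp Require Import all_solvable all_field all_character.

Set Implicit Arguments.
Unset Strict Implicit.
Unset Printing Implicit Defensive.

Import GroupScope GRing.Theory.

Section Isaacs.

Variable gT : finGroupType.
Implicit Types (G A H L : {group gT}).

(* The context [1 < e] makes the truncated subtractions exact. *)
Definition isaacs_group (e : nat) G : Prop :=
  [/\ 1 < e,
      #|G| = (e ^ 4 - e ^ 3)%N
    & exists i : Iirr G, ('chi[G]_i 1%g = (e ^ 2 - e)%N%:R)%R].

(* [Frobenius L = A ><| H] is not used because it excludes the trivial        *)
(* complement, which is allowed here (#|A| = 2).                              *)
Definition two_transitive_frobenius L A H : Prop :=
  [/\ A ><| H = L, A :!=: 1,
      [transitive H, on A^# | 'J]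
    & semiregular A H].

End Isaacs.

Section SpecialLinear.

Variables (n : nat) (p : nat).

Definition SL_set : {set {'GL_n(p)}} :=
  [set u in 'GL_n(p) | (\det (GLval u) == 1)%R].

Lemma SL_group_set : group_set SL_set.
Proof.
apply/group_setP; split=> [|u v].
  by rewrite !inE GL_1E det1 eqxx.
rewrite !inE => /eqP du /eqP dv.
by apply/eqP; rewrite [GLval _]GL_MxE det_mulmx du dv mulr1.
Qed.

Canonical SL_group := Group SL_group_set.

End SpecialLinear.

Notation "''SL_' n ( p )" := (SL_set n p)
  (at level 8, n at level 2, format "''SL_' n ( p )") : group_scope.

(* Main.v *)
(* Write Z = Z(P). The group H is always solvable, hence so is G, and the list
   of exceptions is never reached.

   Restricting the character of degree e^2 - e to P and comparing degrees and
   norms, every irreducible character of P that is nontrivial on Z vanishes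
   off Z; thus g ^: P contains g * Z for every g in P outside Z. Suppose that
   |H| is even and let t be its involution, which is central in H and inverts Z.
   Then C = C_P(t) is elementary abelian of order e, [C, P] is contained in Z,
   and each y in P yields a map c |-> [c, y] from C to Z that is zero or
   injective: a space W of matrices, all nonzero members of which are
   invertible, stable under the action of H, where t acts trivially on C and
   by -1 on Z. A subgroup SL(2, 3) of H would produce a noninvertible nonzero
   member of W, from a nilpotent combination of the matrices of Q8 on Z.

   It remains to see that a group H acting freely and without subgroup SL(2, 3)
   is solvable. Its Sylow subgroups are cyclic or generalised quaternion. By
   transfer a perfect subgroup has a quaternion Sylow 2-subgroup and a 3-element
   d permuting i, j, k in a subgroup Q8. An element h of order 3 satisfies
   h^2 + h + 1 = 0, so that g + g^-1 is central in the ring generated by two such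
   elements for every g in the group J they generate. If J is even, this yields
   d^3 = 1, hence a subgroup SL(2, 3); so J is odd and in fact abelian. Thus the
   subgroup of order 3 is unique, and transfer to a Sylow 3-subgroup contradicts
   perfectness. *)

From HB Require Import structures.
Require Import Defs.
From mathcomp Require Import all_boot all_order all_fingroup all_algebra.
From mathcomp Require Import all_solvable all_field all_character.

Set Implicit Arguments.
Unset Strict Implicit.
Unset Printing Implicit Defensive.

Import GroupScope GRing.Theory.

(** * Linear identities in additive groups *)

Section AdditiveNormalForm.
Local Open Scope ring_scope.

(** Reified sums over a list of atoms. Two of them agree in every abelian group once the integer
    coefficients of each atom agree, which is decided by computation. Noncommutative ring identities
    are first expanded into such sums. *)
Inductive zexpr := ZVar of nat | Z0 | ZAdd of zexpr & zexpr | ZOpp of zexpr.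

Fixpoint zeval (V : zmodType) (env : seq V) e : V :=
  match e with
  | ZVar i => env`_i
  | Z0 => 0
  | ZAdd e1 e2 => zeval env e1 + zeval env e2
  | ZOpp e1 => - zeval env e1
  end.

Fixpoint zcoef (i : nat) e : int :=
  match e with
  | ZVar j => (j == i)%:Z
  | Z0 => 0
  | ZAdd e1 e2 => zcoef i e1 + zcoef i e2
  | ZOpp e1 => - zcoef i e1
  end.

Lemma zevalE (V : zmodType) (env : seq V) e :
  zeval env e = \sum_(i < size env) env`_i *~ zcoef i e.
Proof.
elim: e => [j||e1 IH1 e2 IH2|e IH] /=.
- have [ltj|gej] := ltnP j (size env).
    rewrite (bigD1 (Ordinal ltj)) //= eqxx mulr1z big1 ?addr0 // => i.
    by rewrite -val_eqE /= eq_sym => /negbTE->; rewrite mulr0z.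
  rewrite nth_default // big1 // => i _; case: eqP => [ji|]; last by rewrite mulr0z.
  by have := ltn_ord i; rewrite -ji ltnNge gej.
- by rewrite big1 // => i _; rewrite mulr0z.
- by rewrite IH1 IH2 -big_split /=; apply: eq_bigr => i _; rewrite mulrzDr.
- by rewrite IH -sumrN; apply: eq_bigr => i _; rewrite mulrNz.
Qed.

Lemma zeval_eq (V : zmodType) (env : seq V) e1 e2 :
    all (fun i => zcoef i e1 == zcoef i e2) (iota 0 (size env)) ->
  zeval env e1 = zeval env e2.
Proof.
move=> /allP eqc; rewrite !zevalE; apply: eq_bigr => i _.
by rewrite (eqP (eqc i _)) // mem_iota ltn_ord.
Qed.

End AdditiveNormalForm.

(* Atoms are compared up to conversion: the constant 1 of a ring may occur
   under several canonical structures. *)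
Ltac zmod_index a l :=
  match l with
  | ?b :: _ => let _ := match goal with _ => unify a b end in constr:(0%N)
  | _ :: ?l' => let i := zmod_index a l' in constr:(S i)
  end.
Ltac zmod_atoms t l :=
  match t with
  | (?a + ?b)%R => let l1 := zmod_atoms a l in zmod_atoms b l1
  | (- ?a)%R => zmod_atoms a l
  | 0%R => l
  | _ => match l with
         | _ => let i := zmod_index t l in l
         | _ => constr:(t :: l)
         end
  end.
Ltac zmod_quote t l :=
  match t with
  | (?a + ?b)%R => let x := zmod_quote a l in let y := zmod_quote b l in
                   constr:(ZAdd x y)
  | (- ?a)%R => let x := zmod_quote a l in constr:(ZOpp x)
  | 0%R => constr:(Z0)
  | _ => let i := zmod_index t l in constr:(ZVar i)
  end.
Ltac zmod :=
  match goal with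
  | |- @eq ?T ?a ?b =>
    let l0 := constr:(@nil T) in
    let l1 := zmod_atoms a l0 in let l := zmod_atoms b l1 in
    let x := zmod_quote a l in let y := zmod_quote b l in
    exact (@zeval_eq _ l x y isT)
  end.
Ltac expand_ring :=
  rewrite ?(mulrDr, mulrDl, mulrN, mulNr, mulr1, mul1r, opprD, opprK, mulrA).

(** * Free actions on rings *)

(** The instances are matrix representations: invertibility of [r h - 1] says that [h] fixes no
    nonzero row vector. *)
Definition free_ring_action (gT : finGroupType) (R : unitRingType)
    (H : {group gT}) (r : gT -> R) : Prop :=
  [/\ r 1%g = 1%R,
      {in H &, {morph r : x y / (x * y)%g >-> (x * y)%R}}
    & forall h, h \in H -> h != 1 -> (r h - 1)%R \is a GRing.unit].

Section FreeRingAction.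

Local Open Scope ring_scope.

Variables (gT : finGroupType) (R : unitRingType).
Variables (H : {group gT}) (r : gT -> R).
Hypothesis freeH : free_ring_action H r.

Let r1 : r 1%g = 1. Proof. by case: freeH. Qed.
Let rM : {in H &, {morph r : x y / (x * y)%g >-> x * y}}.
Proof. by case: freeH. Qed.
Let rU h : h \in H -> h != 1%g -> r h - 1 \is a GRing.unit.
Proof. by case: freeH => _ _; apply. Qed.

Lemma free_ringX h k : h \in H -> r (h ^+ k)%g = r h ^+ k.
Proof.
move=> Hh; elim: k => [|k IHk]; first by rewrite expg0 expr0.
by rewrite expgS exprS rM ?groupX // IHk.
Qed.

Lemma free_ringVl h : h \in H -> r h^-1%g * r h = 1.
Proof. by move=> Hh; rewrite -rM ?groupV // mulVg. Qed.

Lemma free_ringVr h : h \in H -> r h * r h^-1%g = 1.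
Proof. by move=> Hh; rewrite -rM ?groupV // mulgV. Qed.

Lemma free_ring_inj : {in H &, injective r}.
Proof.
move=> x y Hx Hy rxy; apply/eqP; rewrite eq_mulgV1; apply: contraT => ne1.
have := rU (groupM Hx (groupVr Hy)) ne1.
by rewrite rM ?groupV // rxy free_ringVr // subrr unitr0.
Qed.

(** Telescoping: the unit [r h - 1] times the geometric sum is [r h ^+ k - 1 = 0]. *)
Lemma free_ring_sum0 h k :
  h \in H -> h != 1%g -> (h ^+ k = 1)%g -> \sum_(j < k) r h ^+ j = 0.
Proof.
move=> Hh nt_h hk1; have := subrX1 (r h) k.
by rewrite -free_ringX // hk1 r1 subrr => /esym/(canRL (mulKr (rU Hh nt_h)))->;
  rewrite mulr0.
Qed.

Lemma free_ring_involution h :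
  h \in H -> h != 1%g -> (h ^+ 2 = 1)%g -> r h = -1.
Proof.
move=> Hh nt_h h21; have := free_ring_sum0 Hh nt_h h21.
by rewrite !big_ord_recl big_ord0 /= addr0 expr0 addrC => /eqP; rewrite addr_eq0 => /eqP.
Qed.

Lemma free_ring_order3 h :
  h \in H -> h != 1%g -> (h ^+ 3 = 1)%g -> r h * r h = - 1 - r h.
Proof.
move=> Hh nt_h h31; have := free_ring_sum0 Hh nt_h h31.
rewrite !big_ord_recl big_ord0 /= addr0 expr0 expr1 => eq0.
by apply/eqP; rewrite -subr_eq0 -expr2; apply/eqP; rewrite -[RHS]eq0; zmod.
Qed.

(** If [q] were 0 in [R], the Frobenius map would give [(r h - 1) ^+ q = r (h ^+ q) - 1 = 0],
    against invertibility. *)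
Lemma free_ring_prime_neq0 q h :
  prime q -> h \in H -> h != 1%g -> (h ^+ q = 1)%g -> q%:R != 0 :> R.
Proof.
move=> q_pr Hh nt_h hq1; apply/negP=> q0.
have charq : q \in [pchar R] by rewrite inE q_pr.
have := unitrX q (rU Hh nt_h).
rewrite -pFrobenius_autE (pFrobenius_autB_comm _ (commr1 _)).
by rewrite !pFrobenius_autE -free_ringX // hq1 r1 expr1n subrr unitr0.
Qed.

(* Summing over the q + 1 subgroups of order q of <z> x <e> would give
   q = 0 in R. *)
Lemma free_ring_no_rank2 q z e :
    prime q -> z \in H -> e \in H -> commute z e ->
    (z ^+ q = 1)%g -> (e ^+ q = 1)%g -> z != 1%g -> e \in <[z]>%g.
Proof.
move=> q_pr Hz He cze zq1 eq1 nt_z; apply: contraT => notZe.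
have /negP[] := free_ring_prime_neq0 q_pr Hz nt_z zq1; apply/eqP.
have q_gt0 := prime_gt0 q_pr.
have oz : #[z]%g = q.
  by apply: nt_prime_order.
have sum0 (i : 'I_q) : \sum_(j < q) r (z ^+ i * e)%g ^+ j = 0.
  apply: free_ring_sum0; first by rewrite groupM ?groupX.
    apply: contra notZe; rewrite -eq_invg_mul => /eqP <-.
    by rewrite groupV mem_cycle.
  rewrite expgMn; last exact: commuteX2 _ 1%N cze.
  by rewrite -expgM mulnC expgM zq1 eq1 expg1n mulg1.
have: \sum_(i < q) \sum_(j < q) r (z ^+ i * e)%g ^+ j = 0.
  by rewrite big1.
(* The terms with [j = 0] add up to [q]. For [j != 0] the terms are [r (z ^+ j) ^+ i * r (e ^+ j)],
   whose sum over [i] is a vanishing geometric sum. *)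
rewrite exchange_big /= (bigD1 (Ordinal q_gt0)) //= [X in _ + X]big1 => [|j j_neq0]; last first.
  have eqj (i : 'I_q) : r (z ^+ i * e)%g ^+ j = r (z ^+ j)%g ^+ i * r (e ^+ j)%g.
    rewrite -free_ringX ?groupM ?groupX // expgMn; last exact: commuteX2 _ 1%N cze.
    by rewrite rM ?groupX // -expgM mulnC expgM (free_ringX i (groupX j Hz)).
  rewrite (eq_bigr _ (fun i _ => eqj i)) -mulr_suml free_ring_sum0 ?mul0r ?groupX //; last first.
    by rewrite -expgM mulnC expgM zq1 expg1n.
  by apply: contra j_neq0; rewrite -order_dvdn oz /dvdn modn_small //.
by rewrite addr0 (eq_bigr (fun _ => 1)) ?sumr_const ?card_ord // => i _; rewrite expr0.
Qed.

Lemma free_ring_involution_uniq x y :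
  x \in H -> y \in H -> x != 1%g -> y != 1%g -> (x ^+ 2 = 1)%g ->
  (y ^+ 2 = 1)%g -> x = y.
Proof.
by move=> Hx Hy ntx nty x2 y2; apply: free_ring_inj; rewrite ?free_ring_involution.
Qed.

(** A central [z] of order [q] commutes with every [e] of order [q], so that [e] lies in [<[z]>].
    Hence [Q] has a unique subgroup of order [q], which forces it to be cyclic or generalised
    quaternion. *)
Lemma free_ring_pgroup q (Q : {group gT}) :
    prime q -> Q \subset H -> q.-group Q -> Q :!=: 1%g ->
  cyclic Q || (q == 2) && (extremal_class Q == Quaternion).
Proof.
move=> q_pr sQH qQ ntQ; apply/(prime_Ohm1P qQ ntQ).
have pZ : q.-group 'Z(Q)%G by apply: pgroupS (center_sub Q) qQ.
have ntZ : 'Z(Q)%G :!=: 1%g by apply: contraNneq ntQ => /(trivg_center_pgroup qQ)->.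
have [_ qdvd _] := pgroup_pdiv pZ ntZ.
have [z /setIP[Qz /centP cQz] oz] := Cauchy q_pr qdvd.
rewrite (OhmE 1 qQ) expn1.
suff ->: 'Ldiv_q(Q) = <[z]>%g by rewrite genGid -orderE.
apply/setP => e; rewrite !inE; apply/andP/idP => [[Qe eq1]|].
  apply: (free_ring_no_rank2 q_pr) => //; rewrite ?(subsetP sQH) //.
  - by apply: cQz.
  - by rewrite -oz expg_order.
  - exact/eqP.
  - by rewrite -order_gt1 oz prime_gt1.
case/cycleP=> k ->; rewrite groupX // -expgM mulnC expgM -oz expg_order.
by rewrite expg1n.
Qed.

End FreeRingAction.

(** * Transfer *)

Section Transfer.

Variable gT : finGroupType.
Implicit Types (G H K M P Q S X : {group gT}) (x y z g t : gT).

(** The transfer of [x] is a product over the orbits of [<[x]>] on the cosets of [S]; an orbit of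
    length [n] contributes [c ^+ n], and the lengths add up to the index. *)
Lemma transfer_terms_eq (aT : finGroupType) X S (alpha : {morphism S >-> aT})
    (sSX : S \subset X) (abelA : abelian (alpha @* S)) x c :
    x \in X ->
    (forall y n, y \in X -> (x ^+ n) ^ y^-1 \in S ->
       alpha ((x ^+ n) ^ y^-1) = c ^+ n) ->
  FiniteModule.fmval (transfer X abelA x) = c ^+ #|X : S|.
Proof.
move=> Xx alphaX.
have partX := rcosets_cycle_partition sSX Xx.
have trX := transversalP partX.
rewrite (transfer_cycle_expansion sSX abelA Xx trX) FiniteModule.fmval_sum.
rewrite -(sum_index_rcosets_cycle sSX Xx trX).
set T := transversal _ _.
have sTX : {subset T <= X} by apply/subsetP/(transversal_sub trX).
set n := fun y => #|<[x]> : S :* y|.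
rewrite (big_morph (fun k => c ^+ k) (expgD c) (expg0 c)).
apply: eq_bigr => y Ty /=.
have Sxn : (x ^+ n y) ^ y^-1 \in S.
  have := mulg_exp_card_rcosets S x y; rewrite mem_rcoset conjgE invgK mulgA; exact.
rewrite FiniteModule.fmodK ?mem_morphim // alphaX // sTX //.
Qed.

Lemma card2_nt_uniq (aT : finGroupType) (A : {group aT}) (u v : aT) :
  #|A| = 2 -> u \in A -> v \in A -> u != 1 -> v != 1 -> u = v.
Proof.
move=> A2 Au Av ntu ntv; apply/eqP/idPn => neq_uv.
have : #|[set 1; u; v]| <= #|A| by rewrite subset_leq_card // !subUset !sub1set group1 Au.
by rewrite A2 setUC cardsU1 cards2 !inE negb_or ntv (eq_sym v) neq_uv eq_sym ntu.
Qed.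

(* Thompson's transfer lemma, for an element x whose square is central *)
Lemma thompson_transfer X S M x :
    2.-Sylow(X) S -> M \subset S -> #|S : M| = 2 ->
    x \in S -> x ^+ 2 \in M -> x ^+ 2 \in 'Z(X) ->
    (forall K, K <| X -> #|X : K| != 2) ->
  exists2 g, g \in X & x ^ g \in M.
Proof.
move=> sylS sMS iSM Sx Mt /setIP[_ /centP cXt] noindex2.
have [sSX _ oddXS] := and3P sylS; have Xx := subsetP sSX x Sx.
have nMS : S \subset 'N(M) by apply/normal_norm/index2_normal.
apply/exists_inP; apply: contraT; rewrite negb_exists_in => /forall_inP notM.
pose alpha := [morphism of restrm nMS (coset M)].
have imA : alpha @* S = S / M by rewrite morphim_restrm setIid.
have cardA : #|alpha @* S| = 2 by rewrite imA card_quotient.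
have abelA : abelian (alpha @* S) by rewrite cyclic_abelian ?prime_cyclic ?cardA.
have nt_coset z : z \in S -> z \notin M -> coset M z != 1.
  by move=> Sz; apply: contra => /eqP/coset_idr; apply; apply: (subsetP nMS).
have memQ z : z \in S -> coset M z \in S / M by move=> Sz; apply: mem_quotient.
have notMx : x \notin M by rewrite -[x]conjg1 notM.
have c2 : coset M x ^+ 2 = 1.
  by rewrite -morphX ?(subsetP nMS) //= coset_id.
have Mtk k : (x ^+ 2) ^+ k \in M by rewrite groupX.
(* Suppose that no conjugate of [x] lies in [M]. Then each term of the transfer to [S / M] is a
   power of the single nontrivial coset; since [#|X : S|] is odd, [x] has nontrivial transfer and
   the kernel has index 2. *)
have fE : FiniteModule.fmval (transfer X abelA x) = coset M x ^+ #|X : S|.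
  apply: (transfer_terms_eq sSX) => // y n Xy.
  have -> : x ^+ n ^ y^-1 = (x ^ y^-1) ^+ odd n * (x ^+ 2) ^+ n./2.
    rewrite -{1}(odd_double_half n) expgD conjMg conjXg; congr (_ * _).
    rewrite -mul2n expgM conjXg; congr (_ ^+ _).
    by apply/conjg_fixP/commgP; apply: cXt; rewrite groupV.
  have Stk := subsetP sMS _ (Mtk n./2).
  rewrite (groupMr _ Stk) => Sxn; rewrite -[in RHS](odd_double_half n) expgD -mul2n expgM c2 expg1n mulg1.
  rewrite /= /restrm morphM ?(subsetP nMS) //=.
  rewrite (coset_id (Mtk _)) mulg1; case: odd Sxn => /= Sxy; last by rewrite morph1.
  apply: (card2_nt_uniq (A := S / M)); rewrite ?memQ //; first by rewrite card_quotient.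
    by apply: nt_coset => //; apply: notM; rewrite groupV.
  exact: nt_coset.
pose f := [morphism of transfer X abelA].
have /eqP[] := noindex2 _ (ker_normal f).
have <- : #|f @* X| = #|X : 'ker f| by rewrite card_morphim setIid.
apply/eqP; rewrite eqn_leq; apply/andP; split.
  have <- : #|FiniteModule.fmval @: (f @* X)| = #|f @* X|.
    by rewrite card_imset //; apply: val_inj.
  rewrite -cardA subset_leq_card //; apply/subsetP => _ /imsetP[u _ ->].
  exact: FiniteModule.fmodP.
rewrite cardG_gt1; apply/trivgPn; exists (f x); first exact: mem_morphim.
apply/eqP => /(congr1 FiniteModule.fmval); rewrite fE.
have odd_XS : odd #|X : S| by rewrite odd_2'nat.
rewrite -(odd_double_half #|X : S|) odd_XS expgD -mul2n expgM c2 expg1n mulg1.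
by apply/eqP/nt_coset.
Qed.

(** The transfer to [Q] sends [x] to [x ^+ #|X : Q|], which is nontrivial because the index is prime
    to [q]. Its kernel is [K]: the target is an abelian [q]-group, so commutators and [q']-elements
    die. *)
Lemma transfer_abelian_Sylow X Q q x :
    q.-Sylow(X) Q -> abelian Q -> x \in Q -> x != 1 ->
    (forall y n, y \in X -> (x ^+ n) ^ y^-1 \in Q -> (x ^+ n) ^ y^-1 = x ^+ n) ->
  exists K, [/\ K <| X, X^`(1) \subset K, x \notin K
              & {in X, forall u, q^'.-elt u -> u \in K}].
Proof.
move=> sylQ abQ Qx nt_x fusQ.
have [sQX qQ q'XQ] := and3P sylQ; have Xx := subsetP sQX x Qx.
have abelA : abelian (idm Q @* Q) by rewrite morphim_idm.
pose f := [morphism of transfer X abelA].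
have fE := transfer_terms_eq sQX abelA Xx fusQ.
exists ('ker f)%G; split; first exact: ker_normal.
- rewrite -sub_morphim_pre ?der_sub // morphim_der //.
  by apply/trivgP/derG1P; rewrite FinRing.zmod_abelian.
- apply: contra nt_x => /mker /= fx0; move: fE; rewrite fx0 => /esym/eqP.
  rewrite -order_dvdn -order_eq1 -dvdn1 => ox.
  by rewrite -(Gauss_dvdr _ (pnat_coprime (mem_p_elt qQ Qx) q'XQ)) muln1.
move=> u Xu q'u; apply/kerP => //; apply: val_inj => /=.
have Qfu : FiniteModule.fmval (f u) \in Q.
  have : FiniteModule.fmval (f u) \in idm Q @* Q := FiniteModule.fmodP (f u).
  by rewrite morphim_idm.
apply/eqP; rewrite -order_eq1 -dvdn1.
rewrite -(Gauss_dvdr _ (pnat_coprime (mem_p_elt qQ Qfu) q'u)) muln1 order_dvdn.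
by rewrite -FiniteModule.fmvalZ -FinRing.zmodXgE -morphX // expg_order morph1.
Qed.

(** Burnside's argument for the smallest prime divisor: normalisers of subgroups of [Q] centralise
    them, so that conjugation in [X] does not move powers of [x] within [Q]. *)
Lemma cyclic_pdiv_Sylow X Q (q := pdiv #|X|) :
    X :!=: 1 -> q.-Sylow(X) Q -> cyclic Q ->
  exists K, [/\ K <| X, X^`(1) \subset K, K :!=: X
              & {in X, forall u, q^'.-elt u -> u \in K}].
Proof.
move=> ntX sylQ cycQ.
have abQ := cyclic_abelian cycQ.
have [sQX qQ _] := and3P sylQ.
have q_pr : prime q by rewrite pdiv_prime // cardG_gt1.
have ntQ : Q :!=: 1.
  by rewrite -rank_gt0 (rank_Sylow sylQ) p_rank_gt0 mem_primes q_pr cardG_gt0 pdiv_dvd.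
case/trivgPn: ntQ => x Qx nt_x; have Xx := subsetP sQX x Qx.
suff fusQ y n : y \in X -> (x ^+ n) ^ y^-1 \in Q -> (x ^+ n) ^ y^-1 = x ^+ n.
  have [K [nKX sX'K notKx pK]] := transfer_abelian_Sylow sylQ abQ Qx nt_x fusQ.
  by exists K; split=> //; apply: contra notKx => /eqP->.
move=> Xy; set u := x ^+ n => Quy; have Qu : u \in Q by rewrite groupX.
(* A cyclic group has one subgroup of each order, so [u] and its conjugate in [Q] generate the same
   subgroup. *)
have Ny : y^-1 \in 'N_X(<[u]>).
  rewrite inE groupV Xy; apply/normP/eqP.
  rewrite -cycleJ (eq_subG_cyclic cycQ) ?cycle_subG //.
  by rewrite -!orderE orderJ.
suff cN : 'N_X(<[u]>) \subset 'C_X(<[u]>).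
  have /setIP[_ /centP cu] := subsetP cN _ Ny.
  by apply/conjg_fixP/commgP/commute_sym/cu/cycle_id.
have sQC : Q \subset 'C_X(<[u]>).
  by rewrite subsetI sQX sub_abelian_cent // cycle_subG.
rewrite -indexg_eq1; apply: contraT => ntI.
set i := #|_ : _| in ntI.
have i_gt1 : 1 < i by rewrite ltn_neqAle eq_sym ntI indexg_gt0.
(* A prime [r] dividing the index of the centraliser differs from [q], as [Q] centralises [u]. It
   divides the totient of a power of [q], hence [q - 1], although [q] is the smallest prime divisor
   of [#|X|]. *)
have r_pr := pdiv_prime i_gt1; set r := pdiv i in r_pr.
have r_i : r %| i := pdiv_dvd i.
have q_r : q <= r.
  apply: pdiv_min_dvd (prime_gt1 r_pr) (dvdn_trans r_i _).
  exact: dvdn_trans (dvdn_indexg _ _) (cardSg (subsetIl _ _)).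
have cAut : i %| totient #|<[u]>|.
  rewrite -card_Aut_cyclic ?cycle_cyclic //.
  have -> : i = #|conj_aut <[u]> @* 'N_X(<[u]>)|.
    rewrite card_morphim (setIidPr (subsetIr _ _)) ker_conj_aut /i.
    rewrite -[LHS]indexgI -[RHS]indexgI; congr #|_ : _|; apply/setP => w.
    by rewrite !inE; case: (w \in X).
  by rewrite cardSg // Aut_conj_aut.
have r_ne_q : r != q.
  apply: contraTneq r_i => ->.
  rewrite -p'natE //; apply: pnat_dvd (indexgS _ sQC) _.
  have sQN := subset_trans sQC (setIS _ (cent_sub _)).
  by case/and3P: (pHall_subl sQN (subsetIl _ _) sylQ).
have [k ou] := p_natP (mem_p_elt qQ Qu).
have := dvdn_trans r_i cAut; rewrite -orderE ou.
case: k ou => [|k] ou; first by rewrite dvdn1 => /eqP r1; rewrite r1 in r_pr.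
rewrite totient_pfactor // Euclid_dvdM // Euclid_dvdX // (dvdn_prime2 r_pr q_pr).
rewrite (negPf r_ne_q) orbF => /dvdn_leq; rewrite -subn1 subn_gt0 prime_gt1 //.
by move/(_ isT)/(leq_trans q_r); rewrite leqNgt ltn_subrL (prime_gt0 q_pr).
Qed.

End Transfer.

(** * Quaternion Sylow subgroups *)

(** With [y = z ^ d], these are relations of SL(2, 3): [z] and [y] play the roles of i and j in the
    quaternion group, and [d] permutes i, j, k cyclically. The order of [d] is left open. *)
Definition SL23_pair (gT : finGroupType) (t z d : gT) : Prop :=
  [/\ z ^+ 2 = t, z ^ (z ^ d) = z^-1 & (z ^ d) ^ d = z * z ^ d].

(** The relations give [(z * y) ^+ 2 = y ^+ 2], so conjugation by [d] fixes [y ^+ 2] and also maps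
    [z ^+ 2] to it. Conjugation by [y] then both fixes and inverts [z ^+ 2]. *)
Lemma SL23_pair_sqr (gT : finGroupType) (t z d : gT) :
  SL23_pair t z d -> (z ^ d) ^+ 2 = z ^+ 2 /\ (z ^+ 2) ^+ 2 = 1.
Proof.
case; set y := z ^ d => z2 zy yd.
have zyV : z * y = y * z^-1 by rewrite conjgC zy.
have y2d : (y ^+ 2) ^ d = y ^+ 2.
  by rewrite conjXg yd expgS expg1 {1}zyV -mulgA mulKg.
have y2 : y ^+ 2 = z ^+ 2.
  by apply: (conjg_inj d); rewrite y2d conjXg.
split=> //; have : (z ^+ 2) ^ y = z ^+ 2.
  by rewrite -y2; apply/conjg_fixP/commgP/commute_sym/commuteX.
rewrite conjXg zy => zV; rewrite expgS expg1 -{1}zV -expgMn ?mulVg ?expg1n //.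
exact/commute_sym/commuteV.
Qed.

Lemma SL23_pair_expg3 (gT : finGroupType) (t z d : gT) :
  SL23_pair t z d -> z ^ (d ^+ 3) = z /\ (z ^ d) ^ (d ^+ 3) = z ^ d.
Proof.
move=> zd; have [_ zy yd] := zd; have [y2 _] := SL23_pair_sqr zd.
set y := z ^ d in zy yd y2 *.
have zd3 : z ^ (d ^+ 3) = z.
  have zyV : z * y = y * z^-1 by rewrite conjgC zy.
  rewrite !expgS expg0 mulg1 !conjgM -/y yd conjMg yd -/y zyV mulgA.
  by rewrite -[y * y]/(y ^+ 2) y2 expgS expg1 mulgK.
by split=> //; rewrite -conjgM -expgS expgSr conjgM zd3.
Qed.

Section QuaternionFusion.

Variables (gT : finGroupType) (X : {group gT}) (t : gT).
Hypotheses (Zt : t \in 'Z(X)) (t2 : t ^+ 2 = 1).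
Hypothesis uniq_t : forall u, u \in X -> u ^+ 2 = 1 -> u != 1 -> u = t.

Let Xt : t \in X. Proof. by case/setIP: Zt. Qed.
Let cXt u : u \in X -> commute u t.
Proof. by move=> Xu; apply/commute_sym; case/setIP: Zt => _ /centP; apply. Qed.
Let nTX : X \subset 'N(<[t]>).
Proof.
apply/cents_norm/centsP => u Xu _ /cycleP[k ->].
exact/commuteX/cXt.
Qed.
Let XN u : u \in X -> u \in 'N(<[t]>). Proof. exact: (subsetP nTX). Qed.
Local Notation bar := (coset <[t]>).

Let barM : {in X &, {morph bar : u v / u * v}}.
Proof. by move=> u v Xu Xv /=; rewrite morphM ?XN. Qed.
Let barJ : {in X &, {morph bar : u v / u ^ v}}.
Proof. by move=> u v Xu Xv /=; rewrite morphJ ?XN. Qed.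
Let bar_t : bar t = 1. Proof. by rewrite coset_id ?cycle_id. Qed.
Let bar_eq u v : u \in X -> v \in X -> bar u = bar v -> u = v \/ u = v * t.
Proof.
move=> Xu Xv /(rcoset_kercosetP (XN Xu) (XN Xv)).
rewrite mem_rcoset => /cycleP[k].
rewrite -(odd_double_half k) expgD -mul2n expgM t2 expg1n mulg1 => /(canRL (mulgKV _)).
case: odd => /= ->; last by left; rewrite mul1g.
by right; rewrite expg1 cXt.
Qed.

Let sqr_t u : u \in X -> #[u] = 4 -> u ^+ 2 = t.
Proof.
move=> Xu ou; apply: uniq_t; first by rewrite groupX.
  by rewrite -expgM; apply/eqP; rewrite -order_dvdn ou.
by rewrite -order_dvdn ou.
Qed.

Let bar_sqr u : u \in X -> u ^+ 2 = t -> bar u * bar u = 1.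
Proof. by move=> Xu u2; rewrite -barM // -[u * u]/(u ^+ 2) u2. Qed.

(** It is enough to find an element that permutes i, j, k cyclically modulo the central involution:
    a suitable power is a 3-element, and a change of sign makes the relations exact. *)
Let three_cycle_elt i j a :
    i \in X -> j \in X -> a \in X -> i ^+ 2 = t -> j ^+ 2 = t -> i ^ j = i^-1 ->
    bar (i ^ a) = bar j -> bar (j ^ a) = bar (i * j) ->
  exists z d, [/\ z \in X, d \in X, 3.-elt d & SL23_pair t z d].
Proof.
move=> Xi Xj Xa i2 j2 ij ia ja.
have cij : bar i * bar j = bar j * bar i.
  by rewrite -barM // conjgC ij barM ?groupV // morphV ?XN //;
    congr (_ * _); apply/eqP; rewrite eq_invg_mul bar_sqr.
(* The exponent [k * k] kills the part of [a] of order prime to 3, and is 1 modulo 3, so that [d]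
   still induces the same 3-cycle as [a]. *)
pose k := (#[a]`_3^')%N; pose d := a ^+ (k * k).
have Xd : d \in X by rewrite groupX.
have p3d : 3.-elt d.
  apply: pnat_dvd (part_pnat 3 #[a]); rewrite order_dvdn -expgM.
  have -> : (k * k * #[a]`_3 = #[a] * k)%N.
    by rewrite -mulnA mulnC; congr (_ * _)%N; rewrite mulnC partnC.
  by rewrite expgM expg_order expg1n.
have kk1 : (k * k) %% 3 = 1%N.
  have : coprime 3 k by rewrite (pnat_coprime (pnat_id _)) ?part_pnat.
  rewrite -coprime_modr -modnMm; have := ltn_pmod k (isT : 0 < 3).
  by case: (k %% 3) => [|[|[|]]].
set I := bar i; set J := bar j in cij *; set A := bar a.
have IA : I ^ A = J by rewrite -barJ.
have JA : J ^ A = I * J by rewrite -barJ // ja barM.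
have IJA : (I * J) ^ A = I.
  by rewrite conjMg IA JA cij mulgA bar_sqr // mul1g.
have A3 u : ((u ^ A) ^ A) ^ A = u -> u ^ (bar d) = u ^ A.
  move=> uA; rewrite /d morphX ?XN //= -/A (divn_eq (k * k) 3) kk1 addnC expgD.
  rewrite expg1 conjgM mulnC expgM; apply/conjg_fixP/commgP/commuteX.
  apply/commgP/conjg_fixP; rewrite !expgS expg0 mulg1 !conjgM.
  by rewrite uA.
have Id : I ^ bar d = J by rewrite A3 ?IA // JA IJA.
have Jd : J ^ bar d = I * J by rewrite A3 ?JA // IJA IA.
have Xid : i ^ d \in X by rewrite groupJ.
have iid : i ^ (i ^ d) = i^-1.
  case: (bar_eq Xid Xj _) => [|->|->] //; first by rewrite barJ.
  by rewrite conjgM ij; apply/conjg_fixP/commgP/cXt; rewrite groupV.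
have idd2 : (i ^ d) ^+ 2 = t.
  by rewrite -conjXg i2; apply/conjg_fixP/commgP/commute_sym/cXt.
case: (bar_eq (groupJ Xid Xd) (groupM Xi Xid) _) => [|e|e].
- by rewrite !(barJ, barM) ?groupJ // -/I Id.
- by exists i, d; split.
(* Here the image of [i ^ d] under [d] is off by the factor [t]; replacing [i] by [i * t] absorbs
   it. *)
exists (i * t), d; have td : t ^ d = t by apply/conjg_fixP/commgP/commute_sym/cXt.
have tt : t * t = 1 by rewrite -[t * t]/(t ^+ 2).
split; rewrite ?groupM //.
rewrite /SL23_pair (conjMg i t d) td (conjMg (i ^ d) t d) td e (conjMg i t).
have cit := cXt Xi; have cidt := cXt Xid.
split.
- by rewrite expgMn // i2 t2 mulg1.
- rewrite (conjgM _ (i ^ d)) iid invMg; have -> : i^-1 ^ t = i^-1.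
    by apply/conjg_fixP/commgP/cXt; rewrite groupV.
  have -> : t ^ (i ^ d * t) = t by apply/conjg_fixP/commgP/commute_sym/cXt; rewrite groupM.
  by rewrite -[t^-1]mulg1 -tt mulKg; apply: cXt; rewrite groupV.
move: (i ^ d) cidt => w cwt.
by rewrite -!mulgA tt mulg1; congr (_ * _); rewrite mulgA -cwt -mulgA tt mulg1.
Qed.

(** Without subgroups of index 2, Thompson transfer fuses the elements of [S] outside its cyclic
    maximal subgroup [M] into [M]. Modulo [t] this yields transpositions of i, j, k whose products
    are 3-cycles. *)
Lemma quaternion_fusion (S : {group gT}) :
    2.-Sylow(X) S -> extremal_class S = Quaternion ->
    (forall K : {group gT}, K <| X -> #|X : K| != 2) ->
  exists z d, [/\ z \in X, d \in X, 3.-elt d & SL23_pair t z d].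
Proof.
move=> sylS /quaternion_classP[n n_gt2 isoS] noindex2.
have [sSX S2 _] := and3P sylS.
have [[x y] genS _] := generators_quaternion n_gt2 isoS.
have [oS Sx ox S'y] := genS.
have [[_ o4 invx] _ _ _ _] := quaternion_structure n_gt2 genS isoS.
have tt : t * t = 1 by rewrite -[t * t]/(t ^+ 2).
have tJ g : g \in X -> t ^ g = t.
  by move=> Xg; apply/conjg_fixP/commgP/commute_sym/cXt.
pose M := <[x]>%G; have sMS : M \subset S by rewrite cycle_subG.
have [k def_n] : exists k, n = k.+3 by exists (n - 3)%N; rewrite -addn3 subnK.
rewrite {}def_n /= in n_gt2 isoS genS oS ox.
have iSM : #|S : M| = 2.
  by rewrite -divgS // oS -orderE ox expnS mulnK ?expn_gt0.
have XS u : u \in S -> u \in X by apply: (subsetP sSX).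
have XM u : u \in M -> u \in X by move/(subsetP sMS)/XS.
have XS' u : u \in S :\: M -> u \in X by case/setDP=> /XS.
pose z := x ^+ (2 ^ k).
have Mz : z \in M by apply: mem_cycle.
have oz : #[z] = 4.
  have ox4 : #[x] = (2 ^ k * 4)%N by rewrite ox -(expnD 2 k 2) addn2.
  by rewrite orderXdiv ox4 ?dvdn_mulr // mulKn ?expn_gt0.
have z2 : z ^+ 2 = t by apply: sqr_t oz; apply: XM.
have Xz := XM z Mz.
have M_bar v : v \in M -> v ^+ 2 = t -> bar v = bar z.
  move=> Mv v2; have cvz : commute v z^-1.
    by apply: (centsP (cycle_abelian x)); rewrite ?groupV.
  have [vz1|nt_vz] := eqVneq (v * z^-1) 1; first by rewrite -[v](mulgKV z) vz1 mul1g.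
  have <- : t * z = v.
    rewrite -(uniq_t _ _ nt_vz) ?mulgKV ?groupM ?groupV ?XM //.
    by rewrite expgMn // expgVn v2 z2 mulgV.
  by rewrite barM // bar_t mul1g.
have sqr_S' u : u \in S :\: M -> u ^+ 2 = t.
  by move=> S'u; apply: sqr_t (o4 u S'u); apply: XS'.
have S'V u : u \in S :\: M -> u^-1 = u * t.
  by move=> S'u; apply/eqP; rewrite eq_invg_mul mulgA -[u * u]/(u ^+ 2) sqr_S' // tt.
have invM m u : m \in M -> u \in S :\: M -> u * m = m^-1 * u.
  by move=> Mm S'u; rewrite [RHS]conjgC conjVg invx // invgK.
have S'J m u : m \in M -> u \in S :\: M -> u ^ m = m ^- 2 * u.
  by move=> Mm S'u; rewrite conjgE (invM m u) // mulgA -expgVn.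
have S'Jz u : u \in S :\: M -> u ^ z = u * t.
  move=> S'u; rewrite S'J // z2 cXt ?XS' //; congr (_ * _).
  by apply/eqP; rewrite eq_invg_mul tt.
have bar_tmul u : u \in X -> bar (u * t) = bar u.
  by move=> Xu; rewrite barM // bar_t mulg1.
have barV u : u \in X -> u ^+ 2 = t -> bar u^-1 = bar u.
  by move=> Xu u2; rewrite morphV ?XN //; apply/eqP; rewrite eq_invg_mul bar_sqr.
have S'mul m u : m \in M -> u \in S :\: M -> m * u \in S :\: M.
  by move=> Mm /setDP[Su M'u]; rewrite inE groupMl // M'u groupM ?(subsetP sMS m Mm).
have S'mulr m u : m \in M -> u \in S :\: M -> u * m \in S :\: M.
  by move=> Mm S'u; rewrite (invM m u) // S'mul ?groupV.
have bar_com u : u \in S :\: M -> bar (u * z) = bar (z * u).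
  move=> S'u; have Xu := XS' u S'u.
  by rewrite (invM z u) // (barM (groupVr Xz) Xu) (barV z) // -(barM Xz Xu).
have fus u : u \in S :\: M ->
    exists2 g, g \in X & bar (u ^ g) = bar z /\ z ^ g \in S :\: M.
  move=> S'u; have [Su M'u] := setDP S'u; have Xu := XS u Su.
  have Mt : t \in M by rewrite -z2 groupX.
  have [||g0 Xg0 Mug0] := thompson_transfer sylS sMS iSM Su _ _ noindex2.
  - by rewrite sqr_S'.
  - by rewrite sqr_S'.
  have ug2 : (u ^ g0) ^+ 2 = t by rewrite -conjXg sqr_S' ?tJ.
  have bug := M_bar _ Mug0 ug2.
  have Xug0 := groupJ Xu Xg0; have Xzg0 := groupJ Xz Xg0.
  (* Since [u ^ z = u * t] and [u ^ g0] is [z] modulo [t], the element [z ^ g0] inverts [z]. As [S]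
     is a Sylow 2-subgroup of the normaliser of [<[z]>], a further conjugation there brings [z ^ g0]
     into [S]. *)
  have zzg : z ^ (z ^ g0) = z * t.
    have ugz : (u ^ g0) ^ (z ^ g0) = u ^ g0 * t.
      by rewrite -conjJg S'Jz // conjMg tJ.
    case: (bar_eq Xug0 Xz bug) ugz => [->|->] //; rewrite conjMg tJ //.
    by move/mulIg.
  have Nzg : z ^ g0 \in 'N_X(<[z]>).
    by rewrite inE Xzg0 -cycle_subG norms_cycle zzg groupM ?cycle_id // -z2 mem_cycle.
  have sSN : S \subset 'N_X(<[z]>).
    rewrite subsetI sSX; apply: subset_trans (normal_norm (index2_normal sMS iSM)) _.
    by apply: char_norms; apply: (cycle_subgroup_char (a := x)); rewrite cycle_subG.
  have [||h Nh] := Sylow_Jsub (pHall_subl sSN (subsetIl _ _) sylS) (Q := <[z ^ g0]>).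
  - by rewrite cycle_subG.
  - by rewrite /pgroup -orderE orderJ oz.
  rewrite -cycleJ cycle_subG -conjgM => Szg.
  have [Xh /normP nh] := setIP Nh; have Xg : g0 * h \in X by rewrite groupM.
  have bzh : bar (z ^ h) = bar z.
    apply: M_bar; last by rewrite -conjXg z2 tJ.
    have : z ^ h \in <[z]> :^ h by rewrite memJ_conjg cycle_id.
    by rewrite nh; apply/subsetP; rewrite cycle_subG.
  have bugh : bar (u ^ (g0 * h)) = bar z.
    by rewrite conjgM barJ // bug -barJ.
  exists (g0 * h) => //; split=> //; rewrite inE Szg andbT.
  apply: contra M'u => Mzg.
  have : bar (z ^ (g0 * h)) = bar (u ^ (g0 * h)).
    by rewrite bugh M_bar // -conjXg z2 tJ.
  rewrite !barJ // => /conjg_inj/esym/(bar_eq Xu Xz)[->|->] //.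
  by rewrite groupM.
have [g Xg [byg S'zg]] := fus y S'y.
have Xy := XS' y S'y; have Xzg := XS' _ S'zg.
case: k => [|k] in n_gt2 isoS genS oS ox z Mz oz z2 Xz M_bar S'Jz bar_com fus byg S'zg Xzg *; last first.
  (* If [S] has order above 8, [z] has a square root [w] in [M]. Modulo [t], [w] fixes [z] and
     exchanges [z ^ g] with [z * z ^ g], while [w ^ g] fixes [z ^ g] and exchanges [z] with
     [z * z ^ g]; the product is a 3-cycle. *)
  pose w := x ^+ (2 ^ k); have Mw : w \in M by apply: mem_cycle.
  have w2 : w ^+ 2 = z by rewrite -expgM mulnC -expnS.
  have Xw := XM w Mw; have Xwg := groupJ Xw Xg.
  have zw : z ^ w = z.
    by apply/conjg_fixP/commgP/(centsP (cycle_abelian x)).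
  have S'j := S'mul z _ Mz S'zg.
  have zgJ : (z ^ g) ^ (w ^ g) = z ^ g by rewrite -conjJg zw.
  apply: (three_cycle_elt Xz (XS' _ S'j) (groupM Xw Xwg)) => //.
  - by rewrite sqr_S'.
  - by rewrite invx.
  - rewrite conjgM zw barJ // -byg -barJ ?groupJ // -conjJg (S'J w y) // w2 conjMg.
    rewrite conjVg (barM (groupVr Xzg) (groupJ Xy Xg)) barV // ?sqr_S' //.
    rewrite byg -(barM Xzg Xz).
    by rewrite bar_com.
  rewrite (conjgM _ w) (conjMg z _ w) zw (S'J w _ Mw S'zg) w2 mulgA mulgV mul1g zgJ mulgA -[z * z]/(z ^+ 2) z2.
  by rewrite (barM Xt Xzg) bar_t mul1g.
have zx : z = x by rewrite /z expg1.
have S'_bar v : v \in S :\: M -> bar v = bar y \/ bar v = bar (z * y).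
  move=> S'v; have Xv := XS' v S'v.
  have Mvy : v * y^-1 \in M.
    have := rcoset_index2 sMS iSM S'y.
    by rewrite -mem_rcoset => ->.
  rewrite -[v](mulgKV y) (barM (XM _ Mvy) Xy); move: (v * _) Mvy => m Mm.
  have Xm := XM m Mm.
  have [m21|nt_m2] := eqVneq (m ^+ 2) 1.
    left; have [->|nt_m] := eqVneq m 1; first by rewrite morph1 mul1g.
    by rewrite (uniq_t Xm m21 nt_m) bar_t mul1g.
  right; rewrite barM // M_bar //; apply: uniq_t nt_m2; first exact: groupX.
  have om : #[m] %| 4 by rewrite -oz zx order_dvdG.
  by rewrite -expgM; apply/eqP; rewrite -order_dvdn.
have S'zy := S'mul z y Mz S'y; have Xzy := XS' _ S'zy.
(* For [S] of order 8, [g] sends [y] to [z] modulo [t] and is a 3-cycle or exchanges them. In the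
   latter case [h] sends [z * y] to [z], and is a 3-cycle or exchanges them; then [g * h] is a
   3-cycle. *)
have [bzg|bzg] := S'_bar _ S'zg; last first.
  apply: (three_cycle_elt Xy Xz Xg) => //; rewrite ?sqr_S' ?S'V ?S'Jz //.
  by rewrite bzg bar_com.
have [h Xh [bzyh S'zh]] := fus _ S'zy.
have [bzh|bzh] := S'_bar _ S'zh.
  apply: (three_cycle_elt Xzy Xz Xh) => //; rewrite ?sqr_S' ?S'V ?S'Jz //.
  by rewrite bzh -mulgA (invM z y) // mulKVg.
apply: (three_cycle_elt Xy Xzy (groupM Xg Xh)) => //; rewrite ?sqr_S' //.
- by rewrite conjgM S'Jz // conjMg tJ // conjgE mulKg S'V.
- by rewrite conjgM barJ ?groupJ // byg -barJ.
have Xyg := groupJ Xy Xg.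
rewrite (conjgM _ g) (barJ (groupJ Xzy Xg) Xh) (conjMg z y g) (barM Xzg Xyg).
rewrite bzg byg -(barM Xy Xz) bar_com // -(barJ Xzy Xh) bzyh.
rewrite mulgA (invM z y) // -mulgA -[y * y]/(y ^+ 2) sqr_S' //.
by rewrite bar_tmul ?groupV // barV.
Qed.

End QuaternionFusion.

(** * Elements of order three *)

Section QuadraticPair.

Local Open Scope ring_scope.

Variables (R : nzRingType) (A B a b s : R).
Hypotheses (defa : a = - 1 - A) (defb : b = - 1 - B).
Hypotheses (AA : A * A = a) (BB : B * B = b).

Hypothesis defs : s = A * B + b * a.

Let cAB c := GRing.comm c A /\ GRing.comm c B.

(* The elements u of the algebra generated by A and B, paired with their image
   u' under the anti-involution that exchanges A with a and B with b. *)
Definition quadratic_pair_span u u' := exists w x y z,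
  [/\ [/\ cAB w, cAB x, cAB y & cAB z],
      u = w + x * A + y * B + z * (A * B)
    & u' = w + x * a + y * b + z * (b * a)].

Let cABD c d : cAB c -> cAB d -> cAB (c + d).
Proof. by move=> [? ?] [? ?]; split; apply/commr_sym/commrD; apply/commr_sym. Qed.
Let cABN c : cAB c -> cAB (- c).
Proof. by move=> [? ?]; split; apply/commr_sym/commrN; apply/commr_sym. Qed.
Let cABM c d : cAB c -> cAB d -> cAB (c * d).
Proof. by move=> [? ?] [? ?]; split; apply/commr_sym/commrM; apply/commr_sym. Qed.
Let cAB1 : cAB 1.
Proof. by split; apply/commr_sym/commr1. Qed.
Let cAB0 : cAB 0.
Proof. by split; apply/commr_sym/commr0. Qed.

Let AAr c : c * A * A = - c - c * A.
Proof. by rewrite -mulrA AA defa; expand_ring. Qed.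
Let BBr c : c * B * B = - c - c * B.
Proof. by rewrite -mulrA BB defb; expand_ring. Qed.
Let AA1 : A * A = - 1 - A. Proof. by rewrite AA defa. Qed.
Let BB1 : B * B = - 1 - B. Proof. by rewrite BB defb. Qed.

Let sE : s = A * B + 1 + A + B + B * A.
Proof. rewrite defs defa defb; expand_ring; zmod. Qed.

Let BA : B * A = s - 1 - A - B - A * B.
Proof. rewrite sE; zmod. Qed.

Let ab : a * b = s - 1 - a - b - b * a.
Proof. rewrite sE defa defb; expand_ring; zmod. Qed.

Let aa1 : a * a = - 1 - a.
Proof. rewrite defa; expand_ring; rewrite AA1; zmod. Qed.
Let bb1 : b * b = - 1 - b.
Proof. rewrite defb; expand_ring; rewrite BB1; zmod. Qed.
Let aar c : c * a * a = - c - c * a.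
Proof. by rewrite -mulrA aa1; expand_ring. Qed.
Let bbr c : c * b * b = - c - c * b.
Proof. by rewrite -mulrA bb1; expand_ring. Qed.

(** Here [a] and [b] are the inverses of [A] and [B], so [s] is the sum of [A * B] and its inverse.
    Its centrality follows from the two quadratic relations alone. *)
Let cs : cAB s.
Proof.
by split; rewrite /GRing.comm sE; expand_ring; rewrite ?AAr ?BBr ?AA1 ?BB1;
  expand_ring; rewrite ?AAr ?BBr; zmod.
Qed.

Let BAB : B * A * B = s * B + 1 + A.
Proof. rewrite BA; expand_ring; rewrite ?BBr ?BB1; expand_ring; zmod. Qed.

Let bab : b * a * b = s * b + 1 + a.
Proof.
have [sA sB] := cs.
have bs : b * s = s * b by rewrite defb; expand_ring; rewrite sB.
rewrite -mulrA ab; expand_ring; rewrite ?bs ?bb1; expand_ring; zmod.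
Qed.

Lemma quadratic_pair_span1 : quadratic_pair_span 1 1.
Proof.
by exists 1, 0, 0, 0; split; first (by split); rewrite !mul0r !addr0.
Qed.

Lemma quadratic_pair_spanA u u' :
  quadratic_pair_span u u' -> quadratic_pair_span (A * u) (u' * a).
Proof.
case=> w [x [y [z [[cw cx cy cz] -> ->]]]].
exists (- x), (w - x), (- z), (y - z); split.
- by split; repeat first [apply: cABD | apply: cABN].
- rewrite !mulrDr !(mulrA A) -!(proj1 cw, proj1 cx, proj1 cy, proj1 cz).
  by expand_ring; rewrite ?AAr; expand_ring; zmod.
by expand_ring; rewrite ?aar; expand_ring; zmod.
Qed.

Lemma quadratic_pair_spanB u u' :
  quadratic_pair_span u u' -> quadratic_pair_span (B * u) (u' * b).
Proof.
case=> w [x [y [z [[cw cx cy cz] -> ->]]]].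
(* The coefficients are read off from [B * A = s - 1 - A - B - A * B] and
   [B * A * B = s * B + 1 + A]. *)
exists (x * (s - 1) - y + z), (z - x), (w - x - y + z * s), (- x); split.
- by split; repeat first [assumption | apply: cABD | apply: cABN | apply: cABM].
- rewrite !mulrDr !(mulrA B) -!(proj2 cw, proj2 cx, proj2 cy, proj2 cz).
  rewrite -!(mulrA x) -!(mulrA z) (mulrA B A) BAB BA.
  by expand_ring; rewrite ?BBr; expand_ring; zmod.
rewrite !mulrDl -!(mulrA x) -!(mulrA z) bab ab.
by expand_ring; rewrite ?bbr; expand_ring; zmod.
Qed.

(** Since [A + a = B + b = -1], the sum is [w + w - x - y + z * s], built from elements commuting
    with [A] and [B]. *)
Lemma quadratic_pair_span_trace u u' :
  quadratic_pair_span u u' -> GRing.comm (u + u') A /\ GRing.comm (u + u') B.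
Proof.
case=> w [x [y [z [[cw cx cy cz] -> ->]]]].
have -> : w + x * A + y * B + z * (A * B) + (w + x * a + y * b + z * (b * a))
  = w + w - x - y + z * s.
  by rewrite defs defa defb; expand_ring; zmod.
have cAB_trace : cAB (w + w - x - y + z * s).
  by repeat first [assumption | apply: cABD | apply: cABN | apply: cABM].
by [].
Qed.

End QuadraticPair.

(** In a finite group, words in the generators without inverses suffice. *)
Lemma gen2_ind (gT : finGroupType) (a b : gT) (P : gT -> Prop) :
    P 1 -> (forall h, h \in <<[set a; b]>> -> P h -> P (a * h)) ->
    (forall h, h \in <<[set a; b]>> -> P h -> P (b * h)) ->
  forall h, h \in <<[set a; b]>> -> P h.
Proof.
move=> P1 Pa Pb h /gen_prodgP[n [c cP ->]].
elim: n c cP => [|n IHn] c cP; first by rewrite big_ord0.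
rewrite big_ord_recl; set g := \prod_(i < n) _.
have Pg : P g by apply: IHn => i; apply: cP.
have Jg : g \in <<[set a; b]>>.
  by apply: group_prod => i _; rewrite mem_gen.
by have := cP ord0; rewrite !inE => /orP[] /eqP ->; auto.
Qed.

Lemma pdiv_even n : 0 < n -> ~~ odd n -> pdiv n = 2.
Proof.
move=> n_gt0 even_n; have n_gt1 : 1 < n by case: n n_gt0 even_n => [|[]].
apply/eqP; rewrite eqn_leq prime_gt1 ?pdiv_prime // andbT.
by rewrite pdiv_min_dvd // dvdn2.
Qed.

Lemma index2_odd_elt (gT : finGroupType) (X K : {group gT}) u :
  K <| X -> #|X : K| = 2 -> u \in X -> u ^+ 3 = 1 -> u \in K.
Proof.
move=> /andP[sKX nKX] iXK Xu u3; have nKu := subsetP nKX u Xu.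
have Ku2 : u ^+ 2 \in K.
  apply: coset_idr; first exact: groupX.
  apply/eqP; rewrite morphX //= -order_dvdn -iXK -card_quotient //.
  by rewrite order_dvdG // mem_quotient.
rewrite -groupV; suff -> : u^-1 = u ^+ 2 by [].
by apply/eqP; rewrite eq_invg_mul -expgS u3.
Qed.

(** * Groups generated by two elements of order three *)

Section OrderThreePairs.

Variables (gT : finGroupType) (R : unitRingType).
Variables (H : {group gT}) (r : gT -> R).
Hypothesis freeH : free_ring_action H r.

Let rM : {in H &, forall x y, r (x * y)%g = (r x * r y)%R}.
Proof. by case: freeH. Qed.
Let rU h : h \in H -> h != 1%g -> (r h - 1)%R \is a GRing.unit.
Proof. by case: freeH => _ _; apply. Qed.

Variables a b : gT.
Hypotheses (Ha : a \in H) (Hb : b \in H).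
Hypotheses (nt_a : a != 1) (nt_b : b != 1) (a3 : a ^+ 3 = 1) (b3 : b ^+ 3 = 1).

Let J := <<[set a; b]>>%G.
Let sJH : J \subset H.
Proof. by rewrite gen_subG subUset !sub1set Ha. Qed.
Let HJ h : h \in J -> h \in H. Proof. exact: (subsetP sJH). Qed.
Let Ja : a \in J. Proof. by rewrite mem_gen ?set21. Qed.
Let Jb : b \in J. Proof. by rewrite mem_gen ?set22. Qed.

Let order3V h : h \in H -> h != 1 -> h ^+ 3 = 1 -> (r h^-1%g = - 1 - r h)%R.
Proof.
move=> Hh nth h3; rewrite -(free_ring_order3 freeH Hh nth h3) -rM //.
by congr r; apply/eqP; rewrite eq_invg_mul -[h * (h * h)]/(h ^+ 3) h3.
Qed.

(** Writing [h] as a word in [a] and [b] puts the pair [r h], [r h^-1] in the span above; its trace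
    commutes with [r a] and [r b], hence with all of [r g]. *)
Lemma order3_pair_trace :
  {in J &, forall h g, GRing.comm (r h + r h^-1%g)%R (r g)}.
Proof.
have [r1 _ _] := freeH.
have eqA := order3V Ha nt_a a3; have eqB := order3V Hb nt_b b3.
have sqA := free_ring_order3 freeH Ha nt_a a3; rewrite -eqA in sqA.
have sqB := free_ring_order3 freeH Hb nt_b b3; rewrite -eqB in sqB.
have spanJ h : h \in J -> quadratic_pair_span (r a) (r b) (r a^-1%g) (r b^-1%g)
    (r h) (r h^-1%g).
  move: h; apply: gen2_ind => [|h Jh|h Jh].
  - by rewrite invg1 r1; apply: quadratic_pair_span1.
  - by rewrite invMg !rM ?groupV ?HJ //; apply: (quadratic_pair_spanA eqA sqA).
  rewrite invMg !rM ?groupV ?HJ //.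
  exact: (quadratic_pair_spanB eqA eqB sqA sqB erefl).
move=> h g Jh; set c := (r h + _)%R.
have [cA cB] : GRing.comm c (r a) /\ GRing.comm c (r b).
  exact: (quadratic_pair_span_trace eqA eqB sqA sqB erefl (spanJ h Jh)).
move: g; apply: gen2_ind => [|g Jg cg|g Jg cg]; first by rewrite r1; apply: commr1.
  by rewrite rM ?HJ //; apply: commrM.
by rewrite rM ?HJ //; apply: commrM.
Qed.

(* The computation takes place in the subring of R generated by J, where every
   r h + (r h)^-1 is central. *)
Lemma order3_pair_cent_quaternion g x y t :
    g \in J -> x \in J -> y \in J -> t \in H -> t != 1 -> t ^+ 2 = 1 ->
    x ^+ 2 = t -> x ^ y = x^-1 -> commute g x -> commute g y ->
  g ^+ 2 = 1.
Proof.
move=> Jg Jx Jy Ht nt_t t2 x2 xy cgx cgy.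
have rt : r t = (- 1)%R by apply: (free_ring_involution freeH Ht nt_t t2).
have xV : (r x^-1%g = - r x)%R.
  have -> : x^-1 = t * x.
    by apply/eqP; rewrite eq_invg_mul -x2 -expgSr -expgS (expgM x 2 2) x2 t2.
  by rewrite rM ?(HJ Jx) // rt mulN1r.
have Hg := HJ Jg; have Hx := HJ Jx; have Hy := HJ Jy.
have yx : (r y * r x = - (r x * r y))%R.
  by rewrite -(rM Hx Hy) conjgC xy rM ?groupV // xV mulrN opprK.
(* The trace of [g * x] is [D * r x], which commutes with [r y]. But [r y] commutes with [D] and
   anticommutes with [r x], so twice [D * r x * r y] vanishes and [D = 0]. *)
pose D := (r g - r g^-1%g)%R.
have cDy : (r y * D = D * r y)%R.
  by rewrite mulrBr mulrBl -!rM ?groupV // cgy (commuteV (commute_sym cgy)).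
have traceE : (r (g * x)%g + r (g * x)^-1%g = D * r x)%R.
  rewrite invMg !rM ?groupV // xV mulNr -(rM Hx (groupVr Hg)).
  by rewrite (commuteV (commute_sym cgx)) rM ?groupV // mulrBl.
have := order3_pair_trace (groupM Jg Jx) Jy.
rewrite traceE /GRing.comm mulrA cDy -!(mulrA D) yx mulrN => eqDxy.
have Dxy0 : (D * (r x * r y) = 0)%R.
  have unit2 := rU Ht nt_t; rewrite rt in unit2.
  apply: (mulIr unit2); rewrite mul0r mulrDr !mulrN !mulr1 {1}eqDxy.
  by rewrite opprK subrr.
have D0 : D = 0%R.
  have := congr1 (fun u => u * r (x * y)^-1%g)%R Dxy0.
  by rewrite -rM // -mulrA (free_ringVr freeH) ?groupM // mulr1 mul0r.
have gV : g = g^-1 by apply: (free_ring_inj freeH); rewrite ?groupV // (subr0_eq D0).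
by rewrite expgS {1}gV expg1 mulVg.
Qed.

(** A nontrivial [c] in an abelian normal subgroup is shown to be central. Then [r c - r c^-1] is a
    central unit in the ring generated by [J], and the trace of [c * g] forces [g] to commute with
    every [h]. *)
Lemma order3_pair_odd_abelian : odd #|J| -> solvable J -> abelian J.
Proof.
move=> oddJ solJ; have [J1|ntJ] := eqVneq (J : {set gT}) 1.
  by rewrite J1 abelian1.
have [N [sNJ nsNJ ntN /is_abelemP[q _ /abelem_abelian abN]]] :=
  solvable_norm_abelem solJ (normal_refl J) ntJ.
have [c Nc ntc] := trivgPn _ ntN; have Jc := subsetP sNJ c Nc.
have odd_elt h : h \in J -> h ^+ 2 = 1 -> h = 1.
  move=> Jh h2; apply/eqP; rewrite -order_eq1 -dvdn1.
  have <- : gcdn 2 #[h] = 1%N by apply/eqP; rewrite -/(coprime 2 _) coprime2n (oddSg _ oddJ) ?cycle_subG.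
  by rewrite dvdn_gcd dvdnn order_dvdn h2 eqxx.
have cJ g : g \in J -> c ^ g = c.
  move=> Jg; have Jcg := groupJ Jc Jg; have Ncg : c ^ g \in N.
    by rewrite memJ_norm // (subsetP (normal_norm nsNJ)).
  have Hg := HJ Jg; have Hc := HJ Jc; have Hcg := HJ Jcg.
  have traceJ : (r (c ^ g) + r (c ^ g)^-1%g = r c + r c^-1%g)%R.
    rewrite -conjVg !conjgE !rM ?groupM ?groupV // -mulrDr -mulrDl.
    by rewrite (order3_pair_trace Jc Jg) mulrA (free_ringVl freeH) // mul1r.
  (* If [g] inverts [c], then [g ^+ 2], of which [g] is a power, centralises [c]. Otherwise equality
     of the traces of [c ^ g] and [c] gives [(r (c ^ g) - r c) * (r (c ^ g) - r c^-1) = 0] with a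
     unit as second factor. *)
  have [cgV|ncgV] := eqVneq (c ^ g) c^-1.
    have c2 : c ^ (g ^+ 2) = c by rewrite conjgM cgV conjVg cgV invgK.
    have c1 : c ^ g = c.
      have -> : g = (g ^+ 2) ^+ uphalf #[g].
        rewrite -expgM mul2n odd_uphalfK ?(oddSg _ oddJ) ?cycle_subG //.
        by rewrite expgS expg_order mulg1.
      elim: (uphalf _) => [|m IHm]; first by rewrite expg0 conjg1.
      by rewrite expgS conjgM c2.
    by [].
  apply: (free_ring_inj freeH) => //; apply/eqP; rewrite -subr_eq0; apply/eqP.
  have unitD : (r (c ^ g) - r c^-1%g)%R \is a GRing.unit.
    have -> : (r (c ^ g) - r c^-1%g = r c^-1%g * (r (c * c ^ g)%g - 1))%R.
      by rewrite mulrBr mulr1 -(rM (groupVr Hc) (groupM Hc Hcg)) mulKg.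
    have nt_cc : c * c ^ g != 1.
      by apply: contra ncgV => /eqP/(canRL (mulKg c))->; rewrite mulg1.
    rewrite unitrMr; first exact: rU (groupM Hc Hcg) nt_cc.
    by apply/unitrP; exists (r c); rewrite (free_ringVr freeH) ?(free_ringVl freeH).
  apply: (mulIr unitD); rewrite mul0r mulrBl !mulrBr -!rM ?groupV //.
  rewrite mulgV -(centsP abN _ Ncg _ Nc).
  have -> : (r (c ^ g * c ^ g)%g = r (c ^ g) * (r c + r c^-1%g) - 1)%R.
    rewrite -traceJ mulrDr -!rM ?groupV // mulgV; case: freeH => -> _ _.
    by rewrite addrK.
  by rewrite mulrDr -!rM ?groupV //; case: freeH => -> _ _; zmod.
have cent_c h : h \in J -> commute c h.
  by move=> Jh; apply/commgP/conjg_fixP/cJ.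
apply/centsP => g Jg h Jh.
have [Hg Hh Hc] := And3 (HJ Jg) (HJ Jh) (HJ Jc).
have traceE : (r (c * g)%g + r (c * g)^-1%g
    = (r c - r c^-1%g) * r g + r c^-1%g * (r g + r g^-1%g))%R.
  have -> : (c * g)^-1 = c^-1 * g^-1.
    rewrite invMg; apply/commute_sym/commuteV/commute_sym/commuteV/commute_sym.
    exact: cent_c.
  by rewrite !rM ?groupV // mulrBl mulrDr; zmod.
have := order3_pair_trace (groupM Jc Jg) Jh.
rewrite traceE /GRing.comm [LHS]mulrDl [RHS]mulrDr.
have -> : (r h * (r c^-1%g * (r g + r g^-1%g))
    = r c^-1%g * (r g + r g^-1%g) * r h)%R.
  rewrite -[RHS]mulrA (order3_pair_trace Jg Jh) !mulrA -!rM ?groupV //.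
  by rewrite (commuteV (commute_sym (cent_c h Jh))).
have unitD : (r c - r c^-1%g)%R \is a GRing.unit.
  have -> : (r c - r c^-1%g = r c^-1%g * (r (c * c)%g - 1))%R.
    by rewrite mulrBr mulr1 -(rM (groupVr Hc) (groupM Hc Hc)) mulKg.
  have nt_cc : c * c != 1 by apply: contra ntc => /eqP/(odd_elt c Jc)->.
  rewrite unitrMr; first exact: rU (groupM Hc Hc) nt_cc.
  by apply/unitrP; exists (r c); rewrite (free_ringVr freeH) ?(free_ringVl freeH).
have -> : (r h * ((r c - r c^-1%g) * r g) = (r c - r c^-1%g) * (r h * r g))%R.
  rewrite !mulrA; congr (_ * _)%R; rewrite mulrBr mulrBl -!rM ?groupV //.
  by rewrite (cent_c h Jh) (commuteV (commute_sym (cent_c h Jh))).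
move/addIr; rewrite -mulrA => /(mulrI unitD); rewrite -!rM //.
by move/(free_ring_inj freeH); rewrite !groupM //; apply.
Qed.

End OrderThreePairs.

Lemma nonsolvable_perfect (gT : finGroupType) (G : {group gT}) :
  ~~ solvable G -> exists E : {group gT}, [/\ E \subset G, E^`(1) = E & E :!=: 1].
Proof.
rewrite negb_forall_in => /exists_inP[E /subsetIP[sEG sEE'] ntE].
by exists E; split=> //; apply/eqP; rewrite eqEsubset der_sub derg1.
Qed.

(** * Free actions without SL(2, 3) *)

Section NoSL23.

Variables (gT : finGroupType) (R : unitRingType).
Variables (H : {group gT}) (r : gT -> R).
Hypothesis freeH : free_ring_action H r.

(** For the smallest prime divisor [q], a cyclic Sylow subgroup would yield a proper [K] by
    transfer. The only noncyclic possibility is [q = 2] with a quaternion Sylow subgroup. *)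
Lemma free_ring_quaternion_Sylow (X S : {group gT}) :
    X \subset H -> X :!=: 1 -> 2.-Sylow(X) S ->
    (forall K : {group gT}, K <| X -> X^`(1) \subset K ->
       {in X, forall u, (pdiv #|X|)^'.-elt u -> u \in K} -> K :=: X) ->
  extremal_class S = Quaternion.
Proof.
move=> sXH ntX sylS noK; set q := pdiv #|X| in noK.
have q_pr : prime q by rewrite pdiv_prime // cardG_gt1.
have ncyc (Q : {group gT}) : q.-Sylow(X) Q -> ~~ cyclic Q.
  move=> sylQ; apply/negP => cycQ.
  have [K [nKX sX'K neKX pK]] := cyclic_pdiv_Sylow ntX sylQ cycQ.
  by rewrite (noK K) ?eqxx in neKX.
have quatQ (Q : {group gT}) : q.-Sylow(X) Q ->
    (q == 2) && (extremal_class Q == Quaternion).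
  move=> sylQ; have [sQX qQ _] := and3P sylQ; have ncQ := ncyc Q sylQ.
  have ntQ : Q :!=: 1 by apply: contra ncQ => /eqP->; apply: cyclic1.
  by have := free_ring_pgroup freeH q_pr (subset_trans sQX sXH) qQ ntQ; rewrite (negPf ncQ).
have [Q sylQ] := Sylow_exists q X.
have /andP[/eqP q2 _] := quatQ Q sylQ.
by rewrite q2 in quatQ; have /eqP := quatQ S sylS.
Qed.

(** Every involution is sent to -1 by the injective map [r]; being unique, it is fixed by
    conjugation. *)
Lemma free_ring_central_involution (X : {group gT}) :
    X \subset H -> 2 %| #|X| ->
  exists t, [/\ t \in 'Z(X), t != 1, t ^+ 2 = 1
    & forall u, u \in X -> u ^+ 2 = 1 -> u != 1 -> u = t].
Proof.
move=> sXH /(Cauchy (isT : prime 2))[t Xt ot].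
have nt_t : t != 1 by rewrite -order_gt1 ot.
have t2 : t ^+ 2 = 1 by rewrite -ot expg_order.
have uniq_t u : u \in X -> u ^+ 2 = 1 -> u != 1 -> u = t.
  move=> Xu u2 ntu.
  by apply: (free_ring_involution_uniq freeH); rewrite ?(subsetP sXH).
exists t; split=> //; apply/setIP; split=> //; apply/centP => g Xg.
apply/commgP/conjg_fixP; apply: uniq_t; first by rewrite groupJ.
  by rewrite -conjXg t2 conj1g.
by rewrite conjg_eq1.
Qed.

(** A perfect subgroup would have a quaternion Sylow 2-subgroup, hence even order. *)
Lemma free_ring_odd_solvable (X : {group gT}) :
  X \subset H -> odd #|X| -> solvable X.
Proof.
move=> sXH odX; apply: contraT => /nonsolvable_perfect[E [sEX perfE ntE]].
have [S sylS] := Sylow_exists 2 E; have [sSE _] := andP sylS.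
have : extremal_class S = Quaternion.
  apply: free_ring_quaternion_Sylow sylS _ => //.
    exact: subset_trans sEX sXH.
  by move=> K /normal_sub sKE; rewrite perfE => sEK _; apply/eqP; rewrite eqEsubset sKE.
case/quaternion_classP => n n_gt2 /card_isog oS.
have := oddSg (subset_trans sSE sEX) odX.
by rewrite oS card_quaternion // oddX; case: n n_gt2 {oS}.
Qed.

(** Such [z] and [d] would generate SL(2, 3): [z ^+ 2 != 1] makes [z] and [z ^ d] generate a
    quaternion group of order 8, permuted nontrivially by [d] of order 3. *)
Hypothesis noSL23 : forall z d, z \in H -> d \in H -> z ^+ 2 != 1 ->
  d ^+ 3 = 1 -> ~ SL23_pair (z ^+ 2) z d.

Lemma order3_pair_commute a b :
    a \in H -> b \in H -> a != 1 -> b != 1 -> a ^+ 3 = 1 -> b ^+ 3 = 1 ->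
  commute a b.
Proof.
move=> Ha Hb nta ntb a3 b3; pose J := <<[set a; b]>>%G.
have sJH : J \subset H by rewrite gen_subG subUset !sub1set Ha.
have Ja : a \in J by rewrite mem_gen ?set21.
have Jb : b \in J by rewrite mem_gen ?set22.
have [oddJ|evenJ] := boolP (odd #|J|).
  have := order3_pair_odd_abelian freeH Ha Hb nta ntb a3 b3 oddJ.
  by move/(_ (free_ring_odd_solvable sJH oddJ))/centsP; apply.
have ntJ : J :!=: 1 by apply/trivgPn; exists a.
have J_eq (K : {group gT}) : K <| J -> a \in K -> b \in K -> K :=: J.
  move=> /normal_sub sKJ Ka Kb; apply/eqP; rewrite eqEsubset sKJ gen_subG.
  by rewrite subUset !sub1set Ka.
have [S sylS] := Sylow_exists 2 J.
have order3_elt u : u ^+ 3 = 1 -> 2^'.-elt u.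
  move=> u3; apply: (@pnat_dvd _ 3) => //; by rewrite order_dvdn u3.
have quatS : extremal_class S = Quaternion.
  apply: free_ring_quaternion_Sylow sylS _ => // K nsKJ _.
  by rewrite pdiv_even // => pK; apply: J_eq => //; apply: pK => //; apply: order3_elt.
have [|t [Zt ntt t2 uniq_t]] := free_ring_central_involution sJH; first by rewrite dvdn2.
have [|z [d [Jz Jd p3d pair]]] := quaternion_fusion Zt t2 uniq_t sylS quatS.
  move=> K nsKJ; apply/eqP => iK; have := J_eq K nsKJ.
  rewrite !(index2_odd_elt nsKJ iK) // => /(_ isT isT) eqKJ.
  by rewrite eqKJ indexgg in iK.
have [zd3 yd3] := SL23_pair_expg3 pair; have [z2 zy _] := pair.
(* The cube of [d] centralises the quaternion group, so its square is 1 by the trace argument; as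
   [d] is a 3-element, [d ^+ 3 = 1]. *)
have d6 : (d ^+ 3) ^+ 2 = 1.
  apply: (order3_pair_cent_quaternion freeH Ha Hb nta ntb a3 b3 _ Jz (groupJ Jz Jd)
            _ ntt t2 z2 zy); rewrite ?groupX //.
  - by case/setIP: Zt => Jt _; apply: (subsetP sJH).
  - by apply/commute_sym/commgP/conjg_fixP.
  by apply/commute_sym/commgP/conjg_fixP.
have d3 : d ^+ 3 = 1.
  apply/eqP; rewrite -order_dvdn -(Gauss_dvdr (n := 2) 3 _) -?order_dvdn; last first.
    by rewrite (pnat_coprime p3d).
  by rewrite order_dvdn mulnC expgM d6.
by case: (noSL23 (subsetP sJH z Jz) (subsetP sJH d Jd) _ d3); rewrite z2.
Qed.

Theorem free_ring_solvable : solvable H.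
Proof.
apply: contraT => /nonsolvable_perfect[E [sEH perfE ntE]].
have noK (K : {group gT}) : K <| E -> E^`(1) \subset K -> K :=: E.
  by rewrite perfE => /normal_sub sKE sEK; apply/eqP; rewrite eqEsubset sKE.
have [S sylS] := Sylow_exists 2 E; have [sSE _] := andP sylS.
have quatS : extremal_class S = Quaternion.
  by apply: free_ring_quaternion_Sylow sylS _ => // K nsKE /noK->.
have evenE : 2 %| #|E|.
  have /quaternion_classP[n n_gt2 /card_isog oS] := quatS.
  apply: dvdn_trans (cardSg sSE); rewrite oS card_quaternion //.
  by case: n n_gt2 {oS} => // n _; rewrite expnS dvdn_mulr.
have [t [Zt ntt t2 uniq_t]] := free_ring_central_involution sEH evenE.
have [|z [d [Ez Ed p3d [z2 zy _]]]] := quaternion_fusion Zt t2 uniq_t sylS quatS.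
  move=> K nsKE; apply: contraTneq isT => iK.
  have sE'K : E^`(1) \subset K.
    rewrite der1_min ?normal_norm // cyclic_abelian // prime_cyclic //.
    by rewrite card_quotient ?normal_norm // iK.
  by rewrite (noK K) // indexgg in iK.
have ntd : d != 1.
  apply: contraNneq ntt => d1; rewrite -z2 expgS expg1.
  by move: zy; rewrite d1 conjg1 conjgE mulKg => /eqP; rewrite eq_sym eq_invg_mul.
have E3 : 3 %| #|E|.
  apply: dvdn_trans (order_dvdG Ed).
  have [[|k] od] := p_natP p3d; first by rewrite -order_eq1 od in ntd.
  by rewrite od expnS dvdn_mulr.
have [c Ec oc] := Cauchy (isT : prime 3) E3.
have c3 : c ^+ 3 = 1 by rewrite -oc expg_order.
have ntc : c != 1 by rewrite -order_gt1 oc.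
(* Conjugates of [c] commute with [c], and commuting elements of order 3 lie in one subgroup of
   order 3. *)
have nEc : E \subset 'N(<[c]>).
  apply/subsetP => g Eg; rewrite -cycle_subG norms_cycle.
  have cg3 : (c ^ g) ^+ 3 = 1 by rewrite -conjXg c3 conj1g.
  have Hc := subsetP sEH c Ec; have Hcg := subsetP sEH _ (groupJ Ec Eg).
  apply: (free_ring_no_rank2 freeH (isT : prime 3)) => //.
  by apply: order3_pair_commute; rewrite ?conjg_eq1.
(* The perfect group [E] acts trivially because the automorphism group of a cyclic group is
   abelian. *)
have cEc : E \subset 'C(<[c]>).
  rewrite -{1}perfE -ker_conj_aut -sub_morphim_pre; last first.
    exact: subset_trans (der_sub 1 E) nEc.
  rewrite morphim_der //; apply/trivgP/derG1P.
  apply: abelianS (Aut_conj_aut _ _) (Aut_cyclic_abelian (cycle_cyclic c)).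
have p3c : 3.-group <[c]> by rewrite /pgroup -orderE oc.
have sCE : <[c]> \subset E by rewrite cycle_subG.
have [Q sylQ] := Sylow_superset sCE p3c; rewrite cycle_subG => Qc.
have [sQE pQ _] := and3P sylQ.
have abQ : abelian Q.
  have ntQ : Q :!=: 1 by apply/trivgPn; exists c.
  have := free_ring_pgroup freeH (isT : prime 3) (subset_trans sQE sEH) pQ ntQ.
  by rewrite orbF => /cyclic_abelian.
have [y n Ey _|K [nsKE sE'K notKc _]] := transfer_abelian_Sylow sylQ abQ Qc ntc.
  apply/conjg_fixP/commgP/commute_sym/commuteX.
  by apply: (centP (subsetP cEc _ _)); rewrite ?groupV ?cycle_id.
by rewrite (noK K) // Ec in notKc.
Qed.

End NoSL23.

(** * Invariant spread sets *)

(** Pigeonhole: the set [S] of squares and its translate [T = -1 - S] have the same size, which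
    exceeds half of [#|F|], so they meet. *)
Lemma finField_sum_two_squares (F : finFieldType) :
  exists x y : F, (x ^+ 2 + y ^+ 2 + 1 = 0)%R.
Proof.
pose S := [set (x ^+ 2)%R | x in [set: F]].
pose T := [set (- 1 - y)%R | y in S].
have cardT : #|T| = #|S|.
  by rewrite card_imset // => x y /addrI/oppr_inj.
have cardF : #|F| < #|S| + #|S|.
  pose rt (y : F) := odflt 0%R [pick x | (x ^+ 2)%R == y].
  have rtP x : x = rt (x ^+ 2)%R \/ x = (- rt (x ^+ 2)%R)%R.
    rewrite /rt; case: pickP => [y /eqP yx|/(_ x)]; last by rewrite eqxx.
    have : (x ^+ 2 == y ^+ 2)%R by rewrite yx.
    by rewrite eqf_sqr => /orP[] /eqP; auto.
  pose f (x : F) := ((x ^+ 2)%R, x == rt (x ^+ 2)%R).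
  have injf : injective f.
    move=> x y [eqxy]; have := rtP x; have := rtP y; rewrite eqxy.
    set c := rt _ => yc xc; case: (x =P c) xc => [-> _|_ [//|->]].
      by move/esym/eqP.
    by case: yc => [->|-> //]; rewrite eqxx.
  (* An element is determined by its square and by whether it is the chosen root. The pair
     [(0, false)] is not attained, which makes the inequality strict. *)
  have sfS : f @: [set: F] \subset setX S [set: bool] :\ (0%R, false).
    apply/subsetP => _ /imsetP[x _ ->]; rewrite !inE /= andbT.
    have -> : (x ^+ 2)%R \in S by apply: imset_f; rewrite inE.
    rewrite andbT.
    apply/eqP => -[/eqP]; rewrite expf_eq0 /= => /eqP-> /eqP[].
    rewrite expr0n /rt; case: pickP => [y|/(_ 0%R)]; last by rewrite expr0n eqxx.
    by rewrite expf_eq0 /= => /eqP.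
  have := subset_leq_card sfS; rewrite card_imset // cardsT => leF.
  have : (0%R, false) \in setX S [set: bool].
    by rewrite !inE andbT; apply/imsetP; exists 0%R; rewrite ?expr0n.
  have := cardsD1 (0%R, false) (setX S [set: bool]).
  rewrite cardsX cardsT card_bool muln2 -addnn => -> ->.
  by rewrite add1n ltnS.
have : S :&: T != set0.
  apply: contraTneq cardF => ST0; rewrite -leqNgt -{2}cardT -cardsUI ST0 cards0 addn0.
  exact: max_card.
case/set0Pn => _ /setIP[/imsetP[x _ ->] /imsetP[_ /imsetP[y _ ->] eqxy]].
by exists x, y; rewrite eqxy subrK addNr.
Qed.

(** * Actions in which the element of order three is determined by the quaternion group *)

Section SL23Action.

Variables (gT : finGroupType) (H : {group gT}) (V : zmodType).
Variables (act : gT -> V -> V) (S : V -> Prop).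
Hypothesis actM : forall x y v, x \in H -> y \in H -> S v ->
  act (x * y) v = act y (act x v).
Hypothesis actD : forall x u v, act x (u + v)%R = (act x u + act x v)%R.
Hypothesis actN : forall x u, act x (- u)%R = (- act x u)%R.
Hypothesis actS : forall x v, x \in H -> S v -> S (act x v).

Variables t z d : gT.
Hypotheses (Hz : z \in H) (Hd : d \in H) (zd : SL23_pair t z d).
Hypothesis act_t : forall v, S v -> act t v = (- v)%R.
Hypothesis act_d : forall v, S v -> act d (act d v) = (- v - act d v)%R.

(** If [t] acts as -1 and [d] satisfies [d ^+ 2 + d + 1 = 0], then twice [d] equals
    [z + y - 1 + z * y], as for Hurwitz quaternions. It is used for right multiplication by [rZ] and
    for the action on [W]. *)
Lemma SL23_action v : S v ->
  (act d v + act d v = act z v + act (z ^ d) v - v + act (z * z ^ d)%g v)%R.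
Proof.
set y := z ^ d => Sv; have [z2 zy yd] := zd; rewrite -/y in zy yd.
have [y2 z4] := SL23_pair_sqr zd; rewrite -/y z2 in y2 z4.
have Hy : y \in H by rewrite groupJ.
have dy : d * y = z * d by rewrite [RHS]conjgC.
have dzy : d * (z * y) = y * d by rewrite -yd [RHS]conjgC.
have zy_d : (z * y) ^ d = z.
  have [zd3 _] := SL23_pair_expg3 zd.
  by rewrite -yd /y -!conjgM.
have zyd : z * y * d = d * z by rewrite conjgC zy_d.
have Ht : t \in H by rewrite -z2 groupX.
have Hzy : z * y \in H by rewrite groupM.
have zz u : S u -> act z (act z u) = (- u)%R.
  by move=> Su; rewrite -actM // -[z * z]/(z ^+ 2) z2 act_t.
have yy u : S u -> act y (act y u) = (- u)%R.
  by move=> Su; rewrite -actM // -[y * y]/(y ^+ 2) y2 act_t.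
have SN u : S u -> S (- u)%R.
  by move=> Su; rewrite -act_t //; apply: actS.
have ydz w : S w -> act d (act y (act z w)) = act z (act d w).
  by move=> Sw; rewrite -(actM Hz Hy Sw) -(actM Hzy Hd Sw) zyd actM.
(* The action of [y * d * y * d = y * z * d * d] is evaluated in two ways; comparison gives the
   recursion [E], whose second application, at [act z v], brings back [- act d v]. *)
have ydyd u : S u -> act d (act y (act d (act y u))) = (- u - act d (act y u))%R.
  move=> Su; pose w := (- act z u)%R; have Sw : S w by apply/SN/actS.
  have -> : u = act z w by rewrite actN zz ?opprK.
  by rewrite (ydz w Sw) (ydz _ (actS Hd Sw)) act_d // actD !actN.
have yzdd u : S u -> act d (act y (act d (act y u)))
    = (- act z (act y u) - act d (act z (act y u)))%R.
  move=> Su; have Hyz := groupM Hy Hz; have Hyd := groupM Hy Hd.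
  rewrite -(act_d (actS Hz (actS Hy Su))) -(actM Hy Hd Su) -(actM Hyd Hy Su).
  rewrite -(actM (groupM Hyd Hy) Hd Su) -(actM Hy Hz Su) -(actM Hyz Hd Su).
  by rewrite -(actM (groupM Hyz Hd) Hd Su) -(mulgA y d y) dy !mulgA.
have E u : S u -> act d u = (act y u + act z u + act d (act z u))%R.
  move=> Su; pose w := (- act y u)%R; have Sw : S w by apply/SN/actS.
  have yw : act y w = u by rewrite actN yy ?opprK.
  have := ydyd w Sw; rewrite yzdd // yw opprK => eqw.
  rewrite -[LHS]opprK -[(- act d u)%R](addKr (act y u)) -eqw; zmod.
rewrite {1}(E v Sv) (E _ (actS Hz Sv)) (zz v Sv) actN (actM Hz Hy Sv); zmod.
Qed.

End SL23Action.

(** * No spread set is invariant under SL(2, 3) *)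

Section SpreadSet.

Local Open Scope ring_scope.

Variables (F : finFieldType) (n : nat) (gT : finGroupType) (H : {group gT}).
Variables (rU rZ : gT -> 'M[F]_n.+1).
Hypothesis freeZ : free_ring_action H rZ.
Hypothesis rUM : {in H &, forall x y, rU (x * y)%g = rU x * rU y}.
Hypothesis rU_involution : forall t, t \in H -> (t ^+ 2 = 1)%g -> rU t = 1.

Variable W : 'M[F]_n.+1 -> Prop.
Hypothesis W_lin : forall c M N, W M -> W N -> W (c *: M + N).
Hypothesis W_act : forall h M, h \in H -> W M -> W (rU h^-1%g * M * rZ h).
Hypothesis W_unit : forall M, W M -> M != 0 -> M \is a GRing.unit.
Hypothesis W_nz : exists2 M, W M & M != 0.

Let rZM : {in H &, forall x y, rZ (x * y)%g = rZ x * rZ y}.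
Proof. by case: freeZ. Qed.
Let rU1 : rU 1%g = 1.
Proof. by apply: rU_involution; rewrite ?expg1n. Qed.
Let rUV h : h \in H -> rU h^-1%g * rU h = 1.
Proof. by move=> Hh; rewrite -rUM ?groupV // mulVg. Qed.
Let WD M N : W M -> W N -> W (M + N).
Proof. by move=> WM WN; rewrite -[M]scale1r; apply: W_lin. Qed.
Let W0 : W 0.
Proof.
by have [M WM _] := W_nz; rewrite -(addNr M) -scaleN1r; apply: W_lin.
Qed.
Let WZ c M : W M -> W (c *: M).
Proof. by move=> WM; rewrite -[c *: M]addr0; apply: W_lin. Qed.

Variables z d : gT.
Hypotheses (Hz : z \in H) (Hd : d \in H) (nt_z2 : (z ^+ 2 != 1)%g).
Hypotheses (d3 : (d ^+ 3 = 1)%g) (zd : SL23_pair (z ^+ 2) z d).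

Let t := (z ^+ 2)%g.
Let y := (z ^ d)%g.
Let Hy : y \in H. Proof. by rewrite groupJ. Qed.
Let Ht : t \in H. Proof. by rewrite groupX. Qed.
Let y2 : (y ^+ 2 = t)%g. Proof. by case: (SL23_pair_sqr zd). Qed.
Let t2 : (t ^+ 2 = 1)%g. Proof. by case: (SL23_pair_sqr zd). Qed.
Let Hzy : (z * y)%g \in H. Proof. by rewrite groupM. Qed.
Let nt_d : d != 1%g.
Proof.
apply: contraNneq nt_z2 => d1; have [_ zy _] := zd; rewrite expgS expg1.
by move: zy; rewrite d1 conjg1 conjgE mulKg => /eqP; rewrite eq_sym eq_invg_mul.
Qed.

Let rZt : rZ t = -1. Proof. exact: (free_ring_involution freeZ). Qed.
Let rUt : rU t = 1. Proof. exact: rU_involution. Qed.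
Let rUt_inv : rU t^-1%g = 1.
Proof. by have := rUV Ht; rewrite rUt mulr1. Qed.
Let Z := rZ z.
Let Y := rZ y.
Let ZZ : Z * Z = -1. Proof. by rewrite /Z -rZM // -rZt. Qed.
Let YY : Y * Y = -1. Proof. by rewrite /Y -rZM // -rZt -y2. Qed.
Let zy_yz : (z * y = t * (y * z))%g.
Proof.
have [_ zy _] := zd; rewrite conjgC -/y zy.
have -> : (z^-1 = t * z)%g.
  by apply/eqP; rewrite eq_invg_mul /t -expgSr -expgS (expgM z 2 2) t2.
rewrite [LHS]mulgA [RHS]mulgA; congr (_ * _)%g.
by rewrite -y2; exact: (commuteX 2 (commute_refl y)).
Qed.
Let ZY : Z * Y = - (Y * Z).
Proof. by rewrite /Z /Y -rZM // zy_yz (rZM Ht (groupM Hy Hz)) (rZM Hy Hz) rZt mulN1r. Qed.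
Let ZYZ : Z * Y * Z = Y. Proof. by rewrite ZY mulNr -mulrA ZZ mulrN1 opprK. Qed.
Let ZZY : Z * (Z * Y) = - Y. Proof. by rewrite mulrA ZZ mulN1r. Qed.
Let YZY : Y * (Z * Y) = Z. Proof. by rewrite ZY mulrN mulrA YY mulN1r opprK. Qed.
Let ZYY : Z * Y * Y = - Z. Proof. by rewrite -mulrA YY mulrN1. Qed.
Let ZYZY : Z * Y * (Z * Y) = -1. Proof. by rewrite mulrA ZYZ YY. Qed.
Let two_unit : (1 + 1 : 'M[F]_n.+1) \is a GRing.unit.
Proof.
have [_ _ /(_ t Ht nt_z2)] := freeZ.
by rewrite rZt -opprD unitrN.
Qed.
Let two_inj_row (v : 'rV[F]_n.+1) : v + v = 0 -> v = 0.
Proof.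
move=> vv0; apply: (row_free_inj (A := (1 + 1 : 'M[F]_n.+1))).
  by rewrite row_free_unit.
by rewrite mul0mx mulmxDr mulmx1.
Qed.

Variables k l : F.
Hypothesis kl : k ^+ 2 + l ^+ 2 + 1 = 0.
(** As [Z], [Y] and [Z * Y] anticommute and have square -1, the square of [N] is
    [-(k ^+ 2 + l ^+ 2 + 1) = 0]. *)
Let N := k *: Z + l *: Y + Z * Y.

Let NN : N * N = 0.
Proof.
rewrite /N !(mulrDl, mulrDr) -!(scalerAl, scalerAr) !scalerA.
rewrite ZZ YY ZYZ ZZY YZY ZYY ZYZY ZY (mulrC l k).
have kl1 : (k * k) *: 1 + (l * l) *: 1 + 1 = 0 :> 'M[F]_n.+1.
  by rewrite -[X in _ + X]scale1r -!scalerDl -!expr2 kl scale0r.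
rewrite !scalerN -[RHS]oppr0 -kl1; zmod.
Qed.

Let NZY : N * (Z * Y) + (Z * Y) * N = - (1 + 1).
Proof.
rewrite /N !(mulrDl, mulrDr) -!(scalerAl, scalerAr) ZYZ ZZY YZY ZYY ZYZY !scalerN.
zmod.
Qed.

Let nt_N : N != 0.
Proof.
apply/eqP => N0; move: NZY; rewrite N0 mul0r mulr0 addr0 => /eqP.
by rewrite eq_sym oppr_eq0 => /eqP two0; move: two_unit; rewrite two0 unitr0.
Qed.

(** Otherwise [W] would be stable under right multiplication by [Z] and [Y], hence by the nonzero
    nilpotent [N], and contain a nonzero singular [M * N]. *)
Let rU_z_neq1 : rU z != 1.
Proof.
apply/eqP => rUz.
have rUy : rU y = 1.
  by rewrite /y conjgE !rUM ?groupV ?groupM // rUz mul1r rUV.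
have rUVz : rU z^-1%g = 1 by rewrite -[LHS]mulr1 -rUz rUV.
have rUVy : rU y^-1%g = 1 by rewrite -[LHS]mulr1 -rUy rUV.
have WZr M : W M -> W (M * Z) by move/(W_act Hz); rewrite rUVz mul1r.
have WYr M : W M -> W (M * Y) by move/(W_act Hy); rewrite rUVy mul1r.
have [M WM ntM] := W_nz; have uM := W_unit WM ntM.
have WMN : W (M * N).
  rewrite /N !mulrDr -!scalerAr mulrA; apply: WD; last exact/WYr/WZr.
  by apply: WD; apply: WZ; [apply: WZr | apply: WYr].
case/eqP: nt_N; apply: (mulrI uM); rewrite mulr0; apply/eqP.
apply: contraNT nt_N => ntMN; apply/eqP.
by apply: (mulrI (W_unit WMN ntMN)); rewrite -mulrA NN !mulr0.
Qed.

Let uM (v : 'rV[F]_n.+1) g h : g \in H -> h \in H ->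
  v *m rU (g * h)%g = v *m rU g *m rU h.
Proof. by move=> Hg Hh; rewrite rUM // mulmxA. Qed.
Let dy : (d * y = z * d)%g. Proof. by rewrite [RHS]conjgC. Qed.
Let zyd : (z * y * d = d * z)%g.
Proof.
have [_ _ yd] := zd; have [zd3 _] := SL23_pair_expg3 zd.
rewrite conjgC -/y -yd -!conjgM; congr (_ * _)%g; exact: zd3.
Qed.
Let uzz (v : 'rV[F]_n.+1) : v *m rU z *m rU z = v.
Proof. by rewrite -uM // -[(z * z)%g]/t rUt mulmx1. Qed.
Let uyy (v : 'rV[F]_n.+1) : v *m rU y *m rU y = v.
Proof. by rewrite -uM // -[(y * y)%g]/(y ^+ 2)%g y2 rUt mulmx1. Qed.
Let uyz (v : 'rV[F]_n.+1) : v *m rU y *m rU z = v *m rU z *m rU y.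
Proof. by rewrite -!uM // zy_yz (uM _ Ht (groupM Hy Hz)) rUt mulmx1. Qed.
Let udy (v : 'rV[F]_n.+1) : v *m rU d *m rU y = v *m rU z *m rU d.
Proof. by rewrite -!uM // dy. Qed.
Let udz (v : 'rV[F]_n.+1) : v *m rU d *m rU z = v *m rU z *m rU y *m rU d.
Proof. by rewrite -(uM v Hd Hz) -(uM v Hz Hy) -(uM v Hzy Hd) zyd. Qed.
Let unit_d : rU d \in unitmx.
Proof. by apply/unitrP; exists (rU d^-1%g); rewrite rUV // -rUM ?groupV // mulgV. Qed.
Let d_neq0 (v : 'rV[F]_n.+1) : v != 0 -> v *m rU d != 0.
Proof.
apply: contraNneq => vd0; have := congr1 (mulmx^~ (invmx (rU d))) vd0.
by rewrite mulmxK // mul0mx => ->.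
Qed.

(** On rows, [z] and [y] act as commuting involutions, not both trivially. Some nontrivial weight of
    this four-group occurs, and [d] permutes the three nontrivial weights. *)
Let weight_row : exists u : 'rV[F]_n.+1,
  [/\ u != 0, u *m rU z = u & u *m rU y = - u].
Proof.
have [v vz] : exists v : 'rV[F]_n.+1, v *m rU z != v.
  have [i ri] : exists i, row i (rU z) != row i 1.
    apply/existsP; apply: contraNT rU_z_neq1; rewrite negb_exists => /forallP eqr.
    by apply/eqP/row_matrixP => i; apply/eqP; rewrite -[_ == _]negbK.
  by exists (row i 1); rewrite -row_mul mul1mx.
pose u1 := v - v *m rU z.
have nt1 : u1 != 0 by rewrite subr_eq0 eq_sym.
have u1z : u1 *m rU z = - u1 by rewrite mulmxBl uzz opprB.
have weight1 (w : 'rV[F]_n.+1) : w != 0 -> w *m rU z = - w -> w *m rU y = - w ->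
    exists u : 'rV[F]_n.+1, [/\ u != 0, u *m rU z = u & u *m rU y = - u].
  move=> ntw wz wy; exists (w *m rU d); split; first exact: d_neq0.
    by rewrite udz wz mulNmx wy opprK.
  by rewrite udy wz mulNmx.
have [u1y|] := eqVneq (u1 *m rU y) u1; last first.
  move=> u1y; apply: (weight1 (u1 - u1 *m rU y)).
  - by rewrite subr_eq0 eq_sym.
  - by rewrite mulmxBl uyz u1z mulNmx; zmod.
  by rewrite mulmxBl uyy; zmod.
apply: (weight1 (u1 *m rU d)); first exact: d_neq0.
  by rewrite udz u1z mulNmx u1y mulNmx.
by rewrite udy u1z mulNmx.
Qed.

Let act h (M : 'M[F]_n.+1) := rU h^-1%g * M * rZ h.

Let actM g h M : g \in H -> h \in H -> W M -> act (g * h)%g M = act h (act g M).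
Proof. by move=> Hg Hh _; rewrite /act invMg rUM ?groupV // rZM // !mulrA. Qed.
Let actS h M : h \in H -> W M -> W (act h M). Proof. exact: W_act. Qed.
Let act_t M : W M -> act t M = - M.
Proof.
by rewrite /act rUt_inv rZt mul1r mulrN1.
Qed.

Let rZ_d : rZ d + rZ d = Z + Y - 1 + Z * Y.
Proof.
have := @SL23_action gT H 'M[F]_n.+1 (fun h M => M * rZ h) (fun=> True) _ _ _ _ t z d
  Hz Hd zd _ _ 1 I.
rewrite !mul1r -/y rZM //; apply=> //.
- by move=> g h M Hg Hh _; rewrite rZM // mulrA.
- by move=> h M1 M2; rewrite mulrDl.
- by move=> h M; rewrite mulNr.
- by move=> M _; rewrite rZt mulrN1.
move=> M _; rewrite -mulrA (free_ring_order3 freeZ Hd nt_d d3) mulrBr.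
by rewrite mulrN1.
Qed.

Lemma spread_set_no_SL23_pair : False.
Proof.
have [u [ntu uz uy]] := weight_row.
pose f (M : 'M[F]_n.+1) := u *m (M * Z).
have udz_ : u *m rU d *m rU z = - (u *m rU d) by rewrite udz uz uy mulNmx.
have udy_ : u *m rU d *m rU y = u *m rU d by rewrite udy uz.
have uddz : u *m rU d *m rU d *m rU z = - (u *m rU d *m rU d).
  by rewrite udz udz_ mulNmx udy_ mulNmx.
have uddy : u *m rU d *m rU d *m rU y = - (u *m rU d *m rU d).
  by rewrite udy udz_ mulNmx.
(* The row [s] is fixed by [d] and is nonzero since [s + s *m rU z] is twice [u]. It is killed by
   [act d (act d M) + act d M + M], a member of [W], which therefore vanishes. *)
pose s := u + u *m rU d + u *m rU d *m rU d.
have nts : s != 0.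
  apply: contraNneq ntu => s0; apply/eqP/two_inj_row.
  have : s + s *m rU z = 0 by rewrite s0 mul0mx addr0.
  by rewrite /s !mulmxDl uz udz_ uddz => <-; zmod.
have rUVr h : h \in H -> rU h *m rU h^-1%g = 1.
  by move=> Hh; rewrite mulmxE -rUM ?groupV // mulgV.
have fixV (v : 'rV[F]_n.+1) h : h \in H -> v *m rU h = v -> v *m rU h^-1%g = v.
  by move=> Hh vh; rewrite -{1}vh -mulmxA rUVr // mulmx1.
have uddd : u *m rU d *m rU d *m rU d = u.
  rewrite -(uM u Hd Hd) -(uM u (groupM Hd Hd) Hd).
  by rewrite -mulgA -[(d * (d * d))%g]/(d ^+ 3)%g d3 rU1 mulmx1.
have sd : s *m rU d^-1%g = s.
  by apply: fixV; rewrite // /s !mulmxDl uddd; zmod.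
have act_d M : W M -> act d (act d M) = - M - act d M.
  move=> WM; apply/eqP; rewrite -subr_eq0; apply: contraNT nts => ntM.
  have WM' : W (act d (act d M) - (- M - act d M)).
    rewrite opprD !opprK; apply: WD; first by do 2!apply: actS => //.
    by apply: WD => //; apply: actS.
  apply/eqP/(row_free_inj (A := act d (act d M) - (- M - act d M))).
    by rewrite row_free_unit; apply: W_unit.
  rewrite mul0mx mulmxBr mulmxBr mulmxN /act -!mulmxE !mulmxA !sd.
  rewrite -(mulmxA _ (rZ d) (rZ d)) -[rZ d *m rZ d]/(rZ d * rZ d).
  rewrite (free_ring_order3 freeZ Hd nt_d d3) mulmxBr mulmxN mulmx1; zmod.
have actE M : W M -> act d M + act d M = act z M + act y M - M + act (z * y)%g M.
  move=> WM; apply: (SL23_action actM _ _ actS Hz Hd zd act_t act_d WM).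
  - by move=> h M1 M2; rewrite /act mulrDr mulrDl.
  by move=> h M1; rewrite /act mulrN mulNr.
have uzV : u *m rU z^-1%g = u by apply: fixV.
have uyV : u *m rU y^-1%g = - u.
  by rewrite -[u in LHS]opprK -uy mulNmx -mulmxA rUVr // mulmx1.
have fz M : f (act z M) = f M *m Z.
  by rewrite /f /act -!mulmxE !mulmxA uzV.
have fy M : f (act y M) = f M *m Y.
  rewrite /f /act -!mulmxE !mulmxA uyV !mulNmx -!(mulmxA _ Y) -!(mulmxA _ Z).
  by rewrite !mulmxE ZY mulmxN.
have fzy M : W M -> f (act (z * y)%g M) = f M *m (Z * Y).
  by move=> WM; rewrite actM // fy fz -mulmxE mulmxA.
(* [f] intertwines the action of [z] and [y] on [W] with right multiplication; since both actions of
   [d] obey the same formula in [z] and [y], this extends to [d] after cancelling 2. *)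
have fd M : W M -> f (act d M) = f M *m rZ d.
  move=> WM; apply/eqP; rewrite -subr_eq0; apply/eqP/two_inj_row.
  have -> : f (act d M) - f M *m rZ d + (f (act d M) - f M *m rZ d)
      = f (act d M + act d M) - f M *m (rZ d + rZ d).
    by rewrite mulmxDr /f mulrDl mulmxDr; zmod.
  rewrite actE // rZ_d {1}/f !mulrDl !mulmxDr mulNr mulmxN.
  rewrite -!/(f _) fz fy fzy // mulmxN mulmx1; zmod.
have act_dK M : W M -> act d (act d^-1%g M) = M.
  move=> WM; rewrite -actM ?groupV // mulVg /act invg1 rU1 mul1r.
  by case: freeZ => -> _ _; rewrite mulr1.
have HdV : d^-1%g \in H by rewrite groupV.
have udd_act (v : 'rV[F]_n.+1) M : v *m rU d *m act d M = v *m M *m rZ d.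
  by rewrite /act -!mulmxE !mulmxA -(mulmxA v) rUVr // mulmx1.
have act_yy M : W M -> act y (act y M) = - M.
  by move=> WM; rewrite -actM // -[(y * y)%g]/(y ^+ 2)%g y2 act_t.
have udM M : W M -> u *m rU d *m M = - (f M *m Y).
  move=> WM; apply: oppr_inj; rewrite opprK -fy -mulmxN -act_yy //.
  have WyM := actS Hy WM; set X := act d^-1%g (act y M).
  have WX : W X by apply: actS.
  have eqX : act y M = act d X by rewrite act_dK.
  clearbody X.
  rewrite eqX -actM // dy actM // udd_act fd //.
  by rewrite /f /act -!mulmxE !mulmxA uzV.
have act_zyzy M : W M -> act (z * y)%g (act (z * y)%g M) = - M.
  move=> WM; rewrite -actM // -act_t //; congr (act _ M).
  have [_ _ yd] := zd; rewrite -/y in yd.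
  by rewrite -yd -[((y ^ d) * (y ^ d))%g]/((y ^ d) ^+ 2)%g -conjXg y2 /t conjXg -/y y2.
have dzy : (d * (z * y) = y * d)%g.
  by have [_ _ yd] := zd; rewrite -/y in yd; rewrite -yd [RHS]conjgC.
have uddM M : W M -> u *m rU d *m rU d *m M = - (f M *m (Z * Y)).
  move=> WM; apply: oppr_inj; rewrite opprK -fzy // -mulmxN -act_zyzy //.
  have WyM := actS Hzy WM; set X := act d^-1%g (act (z * y)%g M).
  have WX : W X by apply: actS.
  have eqX : act (z * y)%g M = act d X by rewrite act_dK.
  clearbody X.
  rewrite eqX -actM // dzy actM // udd_act (udM _ (actS Hy WX)) fd // fy.
  by rewrite -(mulmxA _ Y Y) [Y *m Y]YY mulmxN mulmx1 opprK.
(* The three weight rows take [M] to [- f M] times [Z], [Y] and [Z * Y], so this combination takes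
   it to [- f M *m N]. *)
pose w := k *: u + l *: (u *m rU d) + u *m rU d *m rU d.
have wM M : W M -> w *m M = - (f M *m N).
  move=> WM; rewrite /w !mulmxDl -!scalemxAl udM // uddM //.
  have -> : u *m M = - (f M *m Z).
    by rewrite /f -mulmxA -[M *m Z *m Z]mulmxA [Z *m Z]ZZ !mulmxN mulmx1 opprK.
  by rewrite /N !mulmxDr -!scalemxAr !scalerN; zmod.
have ntw : w != 0.
  have ntudd : u *m rU d *m rU d != 0 by rewrite !d_neq0.
  apply: contraNneq ntudd => w0; apply/eqP/two_inj_row.
  have : w + w *m rU z *m rU y = 0 by rewrite w0 !mul0mx addr0.
  rewrite /w !mulmxDl -!scalemxAl uz udz_ uddz !mulNmx uy udy_ uddy opprK => <-.
  by rewrite !scalerN; zmod.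
pose nact M := k *: act z M + l *: act y M + act (z * y)%g M.
have fnact M : W M -> f (nact M) = f M *m N.
  move=> WM; rewrite /f /nact !mulrDl !mulmxDr -!scalerAl -!scalemxAr -!/(f _).
  by rewrite fz fy fzy // /N !mulmxDr -!scalemxAr.
have Wnact M : W M -> W (nact M).
  move=> WM; apply: WD; last exact: actS.
  by apply: WD; apply: WZ; apply: actS.
(* The nonzero row [w] kills [nact M] because [N * N = 0]; as [nact M] is in [W], it is zero. *)
have fN0 M : W M -> f M *m N = 0.
  move=> WM; rewrite -fnact //; suff -> : nact M = 0 by rewrite /f mul0r mulmx0.
  apply/eqP; apply: contraNT ntw => ntNM.
  apply/eqP/(row_free_inj (A := nact M)).
    by rewrite row_free_unit; apply: W_unit => //; apply: Wnact.
  by rewrite mul0mx (wM _ (Wnact M WM)) fnact // -mulmxA [N *m N]NN mulmx0 oppr0.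
have [M WM ntM] := W_nz.
(* [N] also kills [f M *m (Z * Y)], and [N * (Z * Y) + Z * Y * N = -2] leaves twice [f M] equal to
   0. *)
have fM0 : f M = 0.
  have fNZY : f M *m (N * (Z * Y)) = 0.
    by rewrite -[N * (Z * Y)]/(N *m (Z * Y)) mulmxA fN0 // mul0mx.
  have fZYN : f M *m (Z * Y * N) = 0.
    rewrite -[Z * Y * N]/((Z * Y) *m N) mulmxA -fzy // fN0 //; exact: actS.
  apply: two_inj_row; have := congr1 (fun A => f M *m A) NZY.
  rewrite /= mulmxDr fNZY fZYN addr0 mulmxN mulmxDr mulmx1 => /esym/eqP.
  by rewrite oppr_eq0 => /eqP.
have unitMZ : M * Z \is a GRing.unit.
  rewrite unitrMl; first exact: W_unit.
  by apply/unitrP; exists (- Z); rewrite mulNr mulrN ZZ opprK.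
case/eqP: ntu; apply: (row_free_inj (A := M * Z)); first by rewrite row_free_unit.
by rewrite mul0mx.
Qed.

End SpreadSet.

(** * Full ramification over the center *)

(** The chain [n j * d j <= e * n j <= e * (n j * n j)], summed over [j], is squeezed between equal
    bounds, so every nonzero [n j] is 1 with [d j = e]. *)
Lemma extremal_multiplicities (I : finType) (n d : I -> nat) (e : nat) :
    0 < e -> (forall j, d j <= e) -> \sum_j n j * n j <= e - 1 ->
    \sum_j n j * d j = e ^ 2 - e ->
  (forall j, n j != 0 -> d j = e) /\ #|[set j | n j != 0]| = e - 1.
Proof.
move=> e_gt0 le_de le_nn sum_nd.
have ee : (e ^ 2 - e = e * (e - 1))%N by rewrite mulnBr muln1 expnS expn1.
have term j : n j * d j <= e * (n j * n j)
    ?= iff (n j == 0) || ((n j == 1%N) && (d j == e)).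
  apply/leqifP; case: eqVneq => [->|nj] /=; first by rewrite !mul0n muln0.
  case: eqVneq => [->|nj1] /=; last first.
    have n_gt1 : 1 < n j by case: (n j) nj nj1 => [|[]].
    apply: (@leq_ltn_trans (n j * e)%N); first by rewrite leq_mul.
    by rewrite mulnC ltn_pmul2l // -{1}[n j]muln1 ltn_pmul2l // ltnW.
  by rewrite !mul1n muln1; case: eqVneq => // dj; rewrite ltn_neqAle dj le_de.
have le_sum : \sum_j e * (n j * n j) <= e * (e - 1).
  by rewrite -big_distrr leq_mul2l le_nn orbT.
have [le_nd eq_nd] := leqif_sum (P := xpredT) (fun j _ => term j).
have sumE : \sum_j n j * d j = \sum_j e * (n j * n j).
  by apply/eqP; rewrite eqn_leq le_nd /= sum_nd ee.
have {eq_nd} eqj j : (n j == 0%N) || ((n j == 1%N) && (d j == e)).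
  by move: eq_nd; rewrite sumE eqxx => /esym/forall_inP; apply.
split=> [j /negPf nj|]; first by have := eqj j; rewrite nj => /andP[_ /eqP].
apply/eqP; rewrite -(eqn_pmul2l e_gt0) -ee -sum_nd -sum1_card big_distrr /=.
rewrite big_mkcond; apply/eqP/eq_bigr => j _; rewrite inE.
by case/orP: (eqj j) => [/eqP->|/andP[/eqP-> /eqP->]]; rewrite ?mul0n ?mul1n ?muln1.
Qed.

Section FullyRamified.

Import Order.TTheory Num.Theory.
Local Open Scope ring_scope.

Variables (gT : finGroupType) (G P : {group gT}) (e : nat).
Hypotheses (nsPG : P <| G) (cardP : #|P| = (e ^ 3)%N) (cardZ : #|'Z(P)%g| = e).
Hypotheses (e_gt1 : (1 < e)%N) (indexP : #|G : P| = (e - 1)%N).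
Variable i : Iirr G.
Hypothesis chi1 : 'chi[G]_i 1%g = (e ^ 2 - e)%N%:R.

Let deg (j : Iirr P) := irr_degree (socle_of_Iirr j).
Let degE j : 'chi_j 1%g = (deg j)%:R := irr1_degree j.
Let nsZP : ('Z(P) <| P)%g := center_normal P.
Let e_gt0 : (0 < e)%N := ltnW e_gt1.
Let indexZ : #|P : 'Z(P)%g| = (e ^ 2)%N.
Proof. by rewrite -divgS ?center_sub // cardP cardZ expnSr mulnK. Qed.

Let sZ j : ('Z(P) \subset 'Z('chi[P]_j)%CF)%g.
Proof. by rewrite -cap_cfcenter_irr; apply: bigcap_inf. Qed.

Let index_cfcenter j : (#|P : 'Z('chi[P]_j)%CF| <= e ^ 2)%N.
Proof.
by rewrite -indexZ dvdn_leq ?indexg_gt0 // indexgS ?sZ.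
Qed.

Let le_deg j : (deg j <= e)%N.
Proof.
have [le_d _] := irr1_bound j; rewrite -leq_sqr.
apply: leq_trans (index_cfcenter j).
by move: le_d; rewrite degE -natrX ler_nat.
Qed.

(** The square of the degree attains the bound given by the index of the center of the character,
    which must be ['Z(P)]; equality means vanishing off it. *)
Let deg_support j : deg j = e -> 'chi_j \in 'CF(P, 'Z(P)%g).
Proof.
move=> dj; have [le_d eq_d] := irr1_bound j.
have iZ : #|P : 'Z('chi_j)%CF| = (e ^ 2)%N.
  apply/eqP; rewrite eqn_leq index_cfcenter /=.
  by move: le_d; rewrite degE dj -natrX ler_nat.
have <- : 'Z('chi_j)%CF = 'Z(P)%g.
  apply/eqP; rewrite eq_sym eqEcard sZ -(leq_pmul2r (indexg_gt0 P 'Z('chi_j)%CF)).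
  by rewrite Lagrange ?cfcenter_sub // iZ -indexZ Lagrange ?center_sub //=.
by rewrite -eq_d degE dj iZ natrX eqxx.
Qed.

Let mult j := Num.truncn '['Res[P] 'chi_i, 'chi_j].
Let multE j : '['Res[P] 'chi_i, 'chi_j] = (mult j)%:R.
Proof.
by rewrite truncnK // Cnat_cfdot_char_irr // cfRes_char // irr_char.
Qed.

Let degrees : (forall j, mult j != 0%N -> deg j = e)
  /\ #|[set j | mult j != 0%N]| = (e - 1)%N.
Proof.
apply: extremal_multiplicities => //.
  have [] := cfnorm_Res_leif 'chi_i (normal_sub nsPG).
  rewrite cfdot_sum_irr cfnorm_irr mulr1 indexP => le_n _.
  rewrite -(ler_nat algC) natr_sum; apply: le_trans le_n.
  rewrite le_eqVlt; apply/orP; left; apply/eqP; apply: eq_bigr => j _.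
  by rewrite multE conjC_nat natrM.
apply/eqP; rewrite -(eqr_nat algC) -chi1 natr_sum; apply/eqP.
rewrite -(cfRes1 P) [in RHS](cfun_sum_cfdot ('Res[P] 'chi_i)) sum_cfunE.
by apply: eq_bigr => j _; rewrite cfunE multE degE natrM.
Qed.

(** In the sum of squared degrees [e ^ 3], the constituents of the restriction contribute
    [(e - 1) * e ^ 2] and the characters of [P / 'Z(P)] contribute [e ^ 2]; nothing is left. *)
Let trivial_or_degree j : (deg j == e) || ('Z(P) \subset cfker 'chi[P]_j)%g.
Proof.
have [multd cardK] := degrees.
pose K := [set j | mult j != 0%N].
pose L := [set j | ('Z(P) \subset cfker 'chi[P]_j)%g].
have sumP : (\sum_j deg j ^ 2 = e ^ 3)%N.
  apply/eqP; rewrite -(eqr_nat algC) -cardP natr_sum -irr_sum_square; apply/eqP.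
  by apply: eq_bigr => j' _; rewrite degE natrX.
have sumL : (\sum_(j in L) deg j ^ 2 = e ^ 2)%N.
  apply/eqP; rewrite -(eqr_nat algC) -indexZ -card_quotient ?normal_norm //.
  rewrite natr_sum -irr_sum_square.
  have := sum_norm_irr_quo (group1 P) nsZP; rewrite morph1 => sumE.
  apply/eqP; transitivity (\sum_i0 `|'chi[P / 'Z(P)]_i0 1%g| ^+ 2).
    rewrite sumE; apply: eq_big => [j'|j' _]; first by rewrite inE.
    by rewrite degE normr_nat natrX.
  by apply: eq_bigr => j' _; rewrite irr1_degree normr_nat.
have L0 : 0 \in L by rewrite inE irr0 cfker_cfun1 center_sub.
have deg0 : deg 0 = 1%N.
  by apply/eqP; rewrite -(eqr_nat algC) -degE irr0 cfun11.
have KL0 : [disjoint K & L].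
  rewrite disjoints_subset; apply/subsetP => j'; rewrite !inE => Kj'.
  apply/negP => Lj'; have dj' := multd j' Kj'.
  have neq0 : j' != 0 by apply: contraTneq e_gt1 => j0; rewrite -dj' j0 deg0.
  have := sumL; rewrite (bigD1 j') ?inE //= dj' (bigD1 (0 : Iirr P)) /=.
    by rewrite deg0 => /eqP; rewrite -[X in _ == X]addn0 eqn_add2l.
  by rewrite L0 eq_sym neq0.
have sumK : (\sum_(j in K) deg j ^ 2 = (e - 1) * e ^ 2)%N.
  rewrite -cardK -sum_nat_const; apply: eq_bigr => j'; rewrite inE => Kj'.
  by rewrite multd.
have sumKL : (\sum_(j in K :|: L) deg j ^ 2 = e ^ 3)%N.
  rewrite (eq_bigl [predU K & L]) => [|j']; last by rewrite !inE.
  rewrite bigU //= sumK sumL -[X in (_ + X)%N]mul1n -mulnDl subnK //.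
apply: contraT; rewrite negb_or => /andP[dj Lj].
have KLj : j \notin K :|: L.
  by rewrite !inE negb_or Lj andbT; apply: contra dj => /multd ->.
have := sumP; rewrite (bigID (mem (K :|: L))) /= sumKL (bigD1 j) //=.
move/eqP; rewrite -[X in _ == X]addn0 eqn_add2l addn_eq0 expn_eq0 /= andbT.
by rewrite -(eqr_nat algC) -degE (negPf (irr1_neq0 j)).
Qed.

(** If [g * z] were not conjugate to [g], column orthogonality would make a sum vanish in which
    degree [e] characters contribute 0, the others nonnegative values and the trivial one 1. *)
Lemma camina_center g z :
    g \in P -> g \notin 'Z(P)%g -> z \in 'Z(P)%g ->
  exists2 y, y \in P & [~ g, y]%g = z.
Proof.
move=> Pg notZg Zz; have Pz := subsetP (center_sub P) z Zz.
have Pgz : (g * z)%g \in P by rewrite groupM.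
have chig j : (deg j == e) -> 'chi[P]_j g = 0.
  by move/eqP/deg_support/cfun_onP; apply.
have : (g * z)%g \in (g ^: P)%g.
  apply: contraT => notgz.
  have := second_orthogonality_relation (g * z)%g Pg.
  rewrite (negPf notgz) mulr0n => /eqP.
  rewrite (bigD1 (0 : Iirr P)) //= irr0 !cfun1E Pgz Pg conjC1 mulr1.
  rewrite paddr_eq0 ?oner_eq0 //; apply: sumr_ge0 => j _.
  case/orP: (trivial_or_degree j) => [/chig->|kerZ]; first by rewrite conjC0 mulr0.
  by rewrite cfkerMr ?(subsetP kerZ) // mul_conjC_ge0.
case/imsetP => y Py eqgz; exists y => //.
by rewrite commgEl -eqgz mulKg.
Qed.

(** A character of degree [e] vanishes on [C] off 1, so the trivial character of [C] has
    multiplicity [e / #|C|] in it; this is an integer. *)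
Lemma card_TI_center_leq (C : {group gT}) :
  (C \subset P)%g -> (C :&: 'Z(P) = 1)%g -> (#|C| <= e)%N.
Proof.
move=> sCP tiCZ; have [multd cardK] := degrees.
have [j /multd dj] : exists j, mult j != 0%N.
  have : (0 < #|[set j | mult j != 0%N]|)%N by rewrite cardK subn_gt0.
  by case/card_gt0P => j; rewrite inE; exists j.
have := Cnat_cfdot_char (cfRes_char C (irr_char j)) (cfun1_char C).
rewrite cfdotE (bigD1 1%g) //= big1 ?addr0 => [|c /andP[Cc ntc]]; last first.
  rewrite cfResE // (cfun_onP (deg_support dj)) ?mul0r //.
  apply: contra ntc => Zc; rewrite -in_set1 -[[set _]]/(1%g : {set gT}) -tiCZ.
  by rewrite inE Cc.
rewrite cfResE // degE dj cfun11 conjC1 mulr1 => /natrP[k ek].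
have e_eq : e = (#|C| * k)%N.
  apply/eqP; rewrite -(eqr_nat algC) natrM -ek mulrA mulfV ?mul1r //.
  exact: neq0CG.
rewrite [X in (_ <= X)%N]e_eq leq_pmulr // lt0n; apply: contraTneq e_gt0 => k0.
by rewrite e_eq k0 muln0.
Qed.

End FullyRamified.

(** * The centraliser of an involution *)

Section InvolutionOnCaminaGroup.

Variables (gT : finGroupType) (P : {group gT}) (t : gT) (e : nat).
Hypotheses (oddP : odd #|P|) (nPt : t \in 'N(P)) (t2 : t ^+ 2 = 1).
Hypotheses (regZt : 'C_('Z(P))[t] = 1) (cardP : #|P| = (e ^ 3)%N).
Hypotheses (cardZ : #|'Z(P)| = e) (e_gt1 : 1 < e).
Hypothesis camP : forall g z, g \in P -> g \notin 'Z(P) -> z \in 'Z(P) ->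
  exists2 y, y \in P & [~ g, y] = z.
Hypothesis leTI : forall C : {group gT},
  C \subset P -> C :&: 'Z(P) = 1 -> #|C| <= e.

Let C := 'C_P[t]%G.
Let sCP : C \subset P := subsetIl _ _.
Let CP c : c \in C -> c \in P. Proof. exact: (subsetP sCP). Qed.
Let ZP z : z \in 'Z(P) -> z \in P. Proof. exact: (subsetP (center_sub P)). Qed.
Let cZ z g : z \in 'Z(P) -> g \in P -> commute z g.
Proof. by case/setIP => _ /centP cz Pg; apply: cz. Qed.
Let Ct c : c \in C -> c ^ t = c.
Proof. by case/setIP => _ /cent1P ct; apply/conjg_fixP/commgP/commute_sym. Qed.
Let inC c : c \in P -> c ^ t = c -> c \in C.
Proof.
move=> Pc ct; rewrite inE Pc; apply/cent1P.
by apply/commgP/conjg_fixP.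
Qed.
Let PJt y : y \in P -> y ^ t \in P. Proof. by rewrite memJ_norm. Qed.
Let tt y : (y ^ t) ^ t = y.
Proof. by rewrite -conjgM -[t * t]/(t ^+ 2) t2 conjg1. Qed.
Let nZt : t \in 'N('Z(P)).
Proof. exact: (subsetP (char_norms (center_char P))). Qed.
Let CZ1 c : c \in C -> c \in 'Z(P) -> c = 1.
Proof.
by case/setIP=> Pc cc Zc; apply/set1P; rewrite -[[set 1]]/(1 : {set gT}) -regZt inE Zc.
Qed.
Let tiCZ : C :&: 'Z(P) = 1.
Proof.
by apply/trivgP/subsetP => c /setIP[Cc Zc]; rewrite inE; apply/eqP/CZ1.
Qed.
Let Zt z : z \in 'Z(P) -> z ^ t = z^-1.
Proof.
move=> Zz; have Pz := ZP Zz; have Zzt : z ^ t \in 'Z(P) by rewrite memJ_norm.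
apply/eqP; rewrite eq_sym eq_invg_mul; apply/eqP/CZ1; last exact: groupM.
apply: inC; first by rewrite groupM // PJt.
by rewrite conjMg tt; apply: cZ => //; apply: PJt.
Qed.

Let sqrt y : y \in P -> exists2 j, j * j = y & j \in <[y]>.
Proof.
move=> Py; exists (y ^+ uphalf #[y]); last exact: mem_cycle.
rewrite -expgD addnn odd_uphalfK ?(oddSg _ oddP) ?cycle_subG //.
by rewrite expgS expg_order mulg1.
Qed.

(** In odd order [y^-1 * y ^ t] has a square root [j] among its powers; then [t] fixes [y * j] and
    inverts [j^-1]. *)
Let decomp (D : {group gT}) y :
    D \subset P -> (forall x, x \in D -> x ^ t \in D) -> y \in D ->
  exists c i, [/\ c \in C, c \in D, i \in D, i ^ t = i^-1 & y = c * i].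
Proof.
move=> sDP DJ Dy; pose k := y^-1 * y ^ t.
have Dk : k \in D by rewrite groupM ?groupV ?DJ.
have kt : k ^ t = k^-1 by rewrite /k conjMg tt conjVg [RHS]invMg invgK.
have [j jj /cycleP[m defj]] := sqrt (subsetP sDP k Dk).
have jt : j ^ t = j^-1 by rewrite defj conjXg kt expgVn.
have Dj : j \in D by rewrite defj groupX.
exists (y * j), j^-1; split; last by rewrite mulgK.
- apply: inC; first by rewrite (subsetP sDP) ?groupM.
  by rewrite conjMg jt -[y ^ t](mulKVg y) -/k -jj mulgA mulgK.
- by rewrite groupM.
- by rewrite groupV.
by rewrite conjVg jt.
Qed.

(** The elements of [P] commuting with [g] modulo the center, taken as a preimage so as to be a
    group. *)
Let zcent g := (P :&: coset 'Z(P) @*^-1 'C[coset 'Z(P) g])%G.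
Let nZP : P \subset 'N('Z(P)) := normal_norm (center_normal P).
Let zcentP g y : g \in P -> y \in P -> (y \in zcent g) = ([~ g, y] \in 'Z(P)).
Proof.
move=> Pg Py; have [Ng Ny] := (subsetP nZP g Pg, subsetP nZP y Py).
rewrite inE Py /= inE Ny /= inE; apply/cent1P/idP => [cgy | Zgy].
  apply: coset_idr; first by rewrite groupR.
  by rewrite morphR //; apply/eqP/commgP.
by apply/commute_sym/commgP; rewrite -morphR //= coset_id.
Qed.
Let zcentJ g : g \in P -> g ^ t = g \/ g ^ t = g^-1 ->
  forall x, x \in zcent g -> x ^ t \in zcent g.
Proof.
move=> Pg gt x Dx; have [Px _] := setIP Dx; have Pxt := PJt Px.
have Z' : [~ g ^ t, x ^ t] \in 'Z(P) by rewrite -conjRg memJ_norm // -zcentP.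
case: gt Z' => -> // Z'; rewrite zcentP //.
have -> : [~ g, x ^ t] = ([~ g^-1, x ^ t]^-1) ^ g.
  move: (x ^ t) => u.
  by rewrite /commg /conjg !invMg !invgK !mulgA mulgKV.
by rewrite memJ_norm ?groupV // (subsetP nZP).
Qed.

(** A solution [y] of [[~ i, y] = z] is split as [c * j] inside [zcent i]. The central commutator
    [[~ i, j]] of two inverted elements is fixed by [t], hence trivial, and [c] is a solution. *)
Let IC_solve i z : i \in P -> i ^ t = i^-1 -> i \notin 'Z(P) -> z \in 'Z(P) ->
  exists2 c, c \in C & [~ i, c] = z.
Proof.
move=> Pi it notZi Zz; have [y Py iy] := camP Pi notZi Zz.
have Dy : y \in zcent i by rewrite zcentP // iy.
have [|c [j [Cc Dc Dj jt defy]]] := decomp (subsetIl _ _) (zcentJ Pi _) Dy.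
  by right.
have Pj : j \in P by case/setIP: Dj.
have Zij : [~ i, j] \in 'Z(P) by rewrite -zcentP.
have Pc := CP Cc; have Zic : [~ i, c] \in 'Z(P) by rewrite -zcentP.
have ij1 : [~ i, j] = 1.
  apply: CZ1 => //; apply: inC; first by rewrite groupR.
  rewrite conjRg it jt.
  have -> : [~ i^-1, j^-1] = (i * j) * [~ i, j] * (i * j)^-1.
    by rewrite /commg /conjg !invgK invMg !mulgA !mulgK.
  by rewrite -(cZ Zij) ?groupM // mulgK.
exists c => //; rewrite -iy defy commgMJ ij1 mul1g.
by apply/esym/conjg_fixP/commgP/cZ.
Qed.

Let leC : #|C| <= e. Proof. exact: leTI. Qed.

Let decompP y : y \in P -> exists c i, [/\ c \in C, i \in P, i ^ t = i^-1 & y = c * i].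
Proof.
move=> Py; have [c [i [Cc _ Pi it ->]]] := decomp (subxx P) PJt Py.
by exists c, i.
Qed.

Let inverted_nontrivial : exists i, [/\ i \in P, i ^ t = i^-1 & i \notin 'Z(P)].
Proof.
have /subsetPn[y Py notCZy] : ~~ (P \subset C * 'Z(P)).
  apply: contraL e_gt1 => sPCZ; rewrite -leqNgt.
  have e_gt0 : 0 < e by rewrite -cardZ cardG_gt0.
  have := mul_cardG C 'Z(P); rewrite tiCZ cards1 muln1 cardZ => cardCZ.
  have := subset_leq_card sPCZ; rewrite -cardCZ cardP => le_e3.
  have : e * e * e <= e * e * 1.
    by rewrite muln1 -!mulnA -[(e * (e * e))%N]/(e ^ 3)%N (leq_trans le_e3) ?leq_mul.
  by rewrite leq_pmul2l // muln_gt0 e_gt0.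
have [c [i [Cc Pi it defy]]] := decompP Py.
exists i; split=> //; apply: contra notCZy => Zi.
by rewrite defy mem_mulg.
Qed.

(** Commutation with [i] maps part of [C] onto the center, of order [e], while [#|C| <= e]; so it is
    a bijection defined on all of [C]. *)
Let IC_facts i : i \in P -> i ^ t = i^-1 -> i \notin 'Z(P) ->
  [/\ #|C| = e, forall c, c \in C -> [~ i, c] \in 'Z(P)
    & {in C &, injective (fun c => [~ i, c])}].
Proof.
move=> Pi it notZi; pose f c := [~ i, c].
pose D := [set c in C | [~ i, c] \in 'Z(P)].
have sDC : D \subset C by apply/subsetP => c; rewrite inE => /andP[].
have sZf : 'Z(P) \subset f @: D.
  apply/subsetP => z Zz; have [c Cc icz] := IC_solve Pi it notZi Zz.
  by rewrite -icz; apply: imset_f; rewrite inE Cc icz.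
have le1 := subset_leq_card sZf; have le2 := leq_imset_card f D.
have le3 := subset_leq_card sDC; rewrite cardZ in le1.
have cardD : #|D| = #|C|.
  by apply/eqP; rewrite eqn_leq le3 (leq_trans leC) ?(leq_trans le1).
have DC : D = C by apply/eqP; rewrite eqEcard sDC cardD leqnn.
have cardC : #|C| = e.
  by apply/eqP; rewrite eqn_leq leC (leq_trans le1) // (leq_trans le2).
split=> // [c|]; first by rewrite -DC inE => /andP[].
rewrite -DC; apply/imset_injP; rewrite eqn_leq le2 /= (leq_trans _ le1) //.
by rewrite cardD cardC.
Qed.

Theorem involution_centraliser_spread :
  [/\ #|C| = e, abelian C, {in C & P, forall c y, [~ c, y] \in 'Z(P)},
      forall y, y \in P -> {in C, forall c, [~ c, y] = 1}
                        \/ {in C, forall c, [~ c, y] = 1 -> c = 1}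
    & exists2 y, y \in P & {in C, forall c, [~ c, y] = 1 -> c = 1}].
Proof.
have [i0 [Pi0 it0 notZi0]] := inverted_nontrivial.
have [cardC Zi0 inj0] := IC_facts Pi0 it0 notZi0.
have Zci i c : i \in P -> i ^ t = i^-1 -> c \in C -> [~ c, i] \in 'Z(P).
  move=> Pi it Cc; rewrite -groupV invg_comm.
  have [Zi|notZi] := boolP (i \in 'Z(P)); last by have [_ ->] := IC_facts Pi it notZi.
  by rewrite (_ : [~ i, c] = 1) ?group1 //; apply/eqP/commgP/cZ/CP.
(* Commutation with [i0] turns products in [C] into products of central elements, so it takes equal
   values on [c * c'] and [c' * c]. *)
have abC : abelian C.
  apply/centsP => c Cc c' Cc'; have [Pc Pc'] := (CP Cc, CP Cc').
  have commM x y : x \in C -> y \in C -> [~ i0, x * y] = [~ i0, y] * [~ i0, x].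
    move=> Cx Cy; rewrite commgMJ; congr (_ * _).
    by apply/conjg_fixP/commgP/cZ; [apply: Zi0 | apply: CP].
  apply: inj0; rewrite ?groupM // !commM //.
  by apply: cZ; [apply: Zi0 | apply/ZP/Zi0].
have commE c c' i : c \in C -> c' \in C -> [~ c, c' * i] = [~ c, i].
  move=> Cc Cc'; rewrite commgMJ (_ : [~ c, c'] = 1) ?conj1g ?mulg1 //.
  by apply/eqP/commgP; apply: (centsP abC).
have inj i c : i \in P -> i ^ t = i^-1 -> i \notin 'Z(P) -> c \in C -> [~ c, i] = 1 -> c = 1.
  move=> Pi it notZi Cc ci1; have [_ _ inji] := IC_facts Pi it notZi.
  apply: inji => //; rewrite commg1; apply/eqP; rewrite -invg_comm ci1 invg1.
  by [].
split=> //.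
- move=> c y Cc Py; have [c' [i [Cc' Pi it ->]]] := decompP Py.
  by rewrite commE // Zci.
- move=> y Py; have [c' [i [Cc' Pi it ->]]] := decompP Py.
  have [Zi|notZi] := boolP (i \in 'Z(P)).
    by left=> c Cc; rewrite commE //; apply/eqP/commgP/commute_sym/cZ/CP.
  by right=> c Cc; rewrite commE //; apply: inj.
by exists i0 => // c Cc; apply: inj.
Qed.

End InvolutionOnCaminaGroup.

(** * Spread sets of commutators *)

(** Rectangular sizes with an equation between them serve the application, where the two dimensions
    are not convertible; invertibility is stated as injectivity on rows. *)
Lemma spread_set_solvable (F : finFieldType) (nU nZ : nat) (gT : finGroupType)
    (H : {group gT}) (rU : gT -> 'M[F]_nU.+1) (rZ : gT -> 'M[F]_nZ.+1)
    (W : 'M[F]_(nU.+1, nZ.+1) -> Prop) :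
    nU = nZ -> free_ring_action H rZ ->
    {in H &, forall x y, rU (x * y) = (rU x *m rU y)%R} ->
    (forall t, t \in H -> t ^+ 2 = 1 -> rU t = 1%:M%R) ->
    (forall c M N, W M -> W N -> W (c *: M + N)%R) ->
    (forall h M, h \in H -> W M -> W (rU h^-1%g *m M *m rZ h)%R) ->
    (forall M, W M -> M != 0%R -> forall v : 'rV_nU.+1, (v *m M = 0)%R -> v = 0%R) ->
    (exists2 M, W M & M != 0%R) ->
  solvable H.
Proof.
move=> eqn; case: nZ / eqn in rZ W * => freeZ rUM rU2 Wlin Wact Winj Wnz.
apply: (free_ring_solvable freeZ) => z d Hz Hd ntz2 d3 zd.
have [k [l kl]] := finField_sum_two_squares F.
apply: (spread_set_no_SL23_pair freeZ rUM rU2 Wlin Wact _ Wnz Hz Hd ntz2 d3 zd kl).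
move=> M WM ntM; rewrite -[_ \is a _]/(M \in unitmx) -row_free_unit.
exact/inj_row_free/Winj.
Qed.

Lemma linear_mulmx (F : fieldType) (m n : nat) (f : 'rV[F]_m -> 'rV[F]_n) :
  linear f -> exists M, forall u, (u *m M)%R = f u.
Proof.
move=> linf; pose g : {linear 'rV[F]_m -> 'rV[F]_n} :=
  HB.pack f (GRing.isLinear.Build _ _ _ _ f linf).
by exists (lin1_mx g) => u; rewrite mul_rV_lin1.
Qed.

Section CommutatorSpread.

Variables (gT : finGroupType) (p : nat) (P C H : {group gT}).
Let Z := 'Z(P)%G.
Hypotheses (abelZ : p.-abelem Z) (ntZ : Z :!=: 1).
Hypotheses (abelC : p.-abelem C) (ntC : C :!=: 1) (cardC : #|C| = #|Z|).
Hypotheses (nPH : H \subset 'N(P)) (nCH : H \subset 'N(C)).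
Hypothesis regZ : semiregular Z H.
Hypotheses (cCinv : forall t, t \in H -> t ^+ 2 = 1 -> t \in 'C(C)).
Hypothesis sCP : C \subset P.
Hypothesis CP_Z : {in C & P, forall c y, [~ c, y] \in Z}.
Hypothesis CP_inj : forall y, y \in P -> {in C, forall c, [~ c, y] = 1}
                        \/ {in C, forall c, [~ c, y] = 1 -> c = 1}.
Hypothesis CP_nt : exists2 y, y \in P & {in C, forall c, [~ c, y] = 1 -> c = 1}.

Let nZH : H \subset 'N(Z).
Proof. exact: subset_trans nPH (char_norms (center_char P)). Qed.
Let rU := abelem_repr abelC ntC nCH.
Let rZ := abelem_repr abelZ ntZ nZH.
Let vC := rVabelem abelC ntC.
Let wZ := abelem_rV abelZ ntZ.

Lemma semiregular_free_ring_action : free_ring_action H rZ.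
Proof.
split; first exact: repr_mx1.
  by move=> x y Hx Hy; apply: repr_mxM.
move=> h Hh nth; rewrite -[_ \is a _]/(_ \in unitmx) -row_free_unit.
apply: inj_row_free => v; rewrite mulmxBr mulmx1 => /eqP; rewrite subr_eq0 => /eqP vh.
apply: (rVabelem_inj abelZ ntZ); rewrite rVabelem0.
have Zv := mem_rVabelem abelZ ntZ v.
apply/set1P; rewrite -[[set 1]]/(1 : {set gT}) -(regZ (x := h)); last first.
  by rewrite !inE nth.
rewrite inE Zv; apply/cent1P/commgP/conjg_fixP.
by rewrite -(rVabelemJ _ _ nZH) // vh.
Qed.

(** The matrices of the maps [c |-> [~ c, y]] from [C] to [Z]. They form a space: [y ^+ k * y']
    realises the combination of those of [y] and [y'], and conjugating [y] by [h] gives the action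
    of [H]. *)
Let spread (M : 'M['F_p]_((abelem_dim' C).+1, (abelem_dim' Z).+1)) : Prop :=
  exists2 y, y \in P & forall u, (u *m M)%R = wZ [~ vC u, y].

Let vC_mem u : vC u \in C. Proof. exact: mem_rVabelem. Qed.
Let cZ z g : z \in Z -> g \in P -> commute z g.
Proof. by case/setIP => _ /centP cz Pg; apply: cz. Qed.
Let CPz c y : c \in C -> y \in P -> [~ c, y] \in Z. Proof. exact: CP_Z. Qed.
Let PC c : c \in C -> c \in P. Proof. exact: (subsetP sCP). Qed.

Let wZ_inj c y : c \in C -> y \in P -> wZ [~ c, y] = 0%R -> [~ c, y] = 1.
Proof.
move=> Cc Py w0; apply: (abelem_rV_inj (abelE := abelZ) (ntE := ntZ));
  rewrite ?group1 ?CPz //.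
by rewrite abelem_rV_1.
Qed.

Let commCM c y y' : c \in C -> y \in P -> y' \in P ->
  [~ c, y * y'] = [~ c, y] * [~ c, y'].
Proof.
move=> Cc Py Py'; rewrite commgMJ (conjg_fixP _).
  by apply: cZ; [apply: CPz | rewrite groupR // PC].
by apply/commgP/cZ => //; apply: CPz.
Qed.

Let commCX c y k : c \in C -> y \in P -> [~ c, y ^+ k] = [~ c, y] ^+ k.
Proof.
move=> Cc Py; elim: k => [|k IHk]; first by rewrite !expg0 commg1.
by rewrite !expgS commCM ?groupX // IHk.
Qed.

Let commMC c c' y : c \in C -> c' \in C -> y \in P ->
  [~ c * c', y] = [~ c, y] * [~ c', y].
Proof.
move=> Cc Cc' Py; rewrite commMgJ (conjg_fixP _) //.
by apply/commgP/cZ; [apply: CPz | apply: PC].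
Qed.

Let commXC c y k : c \in C -> y \in P -> [~ c ^+ k, y] = [~ c, y] ^+ k.
Proof.
move=> Cc Py; elim: k => [|k IHk]; first by rewrite !expg0 comm1g.
by rewrite !expgS commMC ?groupX // IHk.
Qed.

Let spread_ex y : y \in P -> exists M, forall u, (u *m M)%R = wZ [~ vC u, y].
Proof.
move=> Py; apply: (linear_mulmx (f := fun u => wZ [~ vC u, y])) => k u v.
rewrite /vC rVabelemD rVabelemZ commMC ?groupX ?vC_mem // commXC ?vC_mem //.
have Zu := CPz (vC_mem u) Py; have Zv := CPz (vC_mem v) Py.
by rewrite /wZ (abelem_rV_M _ _ (groupX k Zu) Zv) abelem_rV_X // natr_Zp.
Qed.

Lemma commutator_spread_solvable : solvable H.
Proof.
have freeZ := semiregular_free_ring_action.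
have eq_dim : abelem_dim' C = abelem_dim' Z by rewrite /abelem_dim' cardC.
apply: (spread_set_solvable (W := spread) eq_dim freeZ).
- by move=> x y Hx Hy; apply: (repr_mxM rU).
- move=> t Ht t2; apply/row_matrixP => i; rewrite rowE row1.
  apply: (rVabelem_inj abelC ntC); rewrite rVabelemJ //.
  apply/conjg_fixP/commgP/commute_sym.
  by have /centP := cCinv Ht t2; apply; apply: mem_rVabelem.
- move=> k M N [y Py defM] [y' Py' defN].
  exists (y ^+ k * y'); first by rewrite groupM ?groupX.
  move=> u; rewrite mulmxDr -scalemxAr defM defN (commCM (vC_mem u)) ?groupX // (commCX _ (vC_mem u)) //.
  have Zc := CPz (vC_mem u) Py; have Zc' := CPz (vC_mem u) Py'.
  by rewrite /wZ (abelem_rV_M _ _ (groupX k Zc) Zc') abelem_rV_X // natr_Zp.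
- move=> h M Hh [y Py defM]; exists (y ^ h).
    by rewrite memJ_norm // (subsetP nPH).
  move=> u; rewrite !mulmxA defM /wZ -(abelem_rV_J abelZ ntZ nZH) ?CPz ?vC_mem //.
  rewrite conjRg /vC rVabelemJ ?groupV //.
  by rewrite -conjgM mulVg conjg1.
- move=> M [y Py defM] ntM v vM0.
  case: (CP_inj Py) => [triv|inj].
    case/eqP: ntM; apply/row_matrixP => i; rewrite row0 rowE defM triv //.
    by rewrite /wZ abelem_rV_1.
  apply: (rVabelem_inj abelC ntC); rewrite rVabelem0; apply: inj => //.
  by apply: wZ_inj => //; rewrite -defM.
have [y Py inj] := CP_nt; have [M defM] := spread_ex Py.
exists M; first by exists y.
have [c Cc ntc] := trivgPn _ ntC; apply: contraNneq ntc => M0; apply/eqP/inj => //.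
apply: wZ_inj => //; have := defM (abelem_rV abelC ntC c).
by rewrite M0 mulmx0 /vC abelem_rV_K.
Qed.

End CommutatorSpread.

(** * Solvability of p-closed Isaacs groups *)

Lemma card_regular_kernel (gT : finGroupType) (A H : {group gT}) :
  A :!=: 1 -> [transitive H, on A^# | 'J] -> semiregular A H -> #|A| = #|H|.+1.
Proof.
move=> /trivgPn[z Az ntz] /atransP transH regH.
have Az' : z \in A^# by rewrite !inE ntz.
rewrite (cardsD1 1) group1 add1n; congr _.+1.
rewrite -(transH z Az') card_orbit.
have -> : 'C_H[z | 'J] = 1.
  apply/trivgP/subsetP => h /setIP[Hh /astab1P/= /conjg_fixP/commgP czh].
  rewrite inE; apply: contraT => nth.
  have : z \in 'C_A[h] by rewrite inE Az; apply/cent1P.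
  by rewrite regH ?inE ?nth // (negPf ntz).
by rewrite indexg1.
Qed.

(** Some element has order [p], and all nontrivial elements are conjugate to it. *)
Lemma transitive_pgroup_abelem (gT : finGroupType) (p : nat) (A H : {group gT}) :
    prime p -> p.-group A -> abelian A -> [transitive H, on A^# | 'J] ->
  p.-abelem A.
Proof.
move=> p_pr pA abA transH; have [->|ntA] := eqVneq (A : {set gT}) 1.
  exact: abelem1.
have [_ p_dvd _] := pgroup_pdiv pA ntA; have [z Az oz] := Cauchy p_pr p_dvd.
have Az' : z \in A^# by rewrite !inE Az -order_gt1 oz prime_gt1.
rewrite abelemE // abA; apply/exponentP => x Ax.
have [->|ntx] := eqVneq x 1; first exact: expg1n.
have : x \in A^# by rewrite !inE ntx.
rewrite -(atransP transH z Az') => /imsetP[h _ ->].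
by rewrite /= -conjXg -oz expg_order conj1g.
Qed.

Lemma isaacs_pclosed_solvable (gT : finGroupType) (G P H : {group gT}) (p a e : nat) :
    prime p -> e = (p ^ a)%N -> isaacs_group e G ->
    p.-Sylow(G) P -> P <| G -> p^'.-Hall(G) H -> #|H| = (e - 1)%N ->
    two_transitive_frobenius ('Z(P) <*> H)%G 'Z(P)%G H ->
  solvable G.
Proof.
move=> p_pr def_e [e_gt1 cardG [i chi1]] sylP nsPG hallH cardH.
case=> _ ntZ transH regH.
have [sPG pP _] := and3P sylP; have [sHG p'H _] := and3P hallH.
have e_gt0 := ltnW e_gt1.
have cardZ : #|'Z(P)| = e.
  by rewrite (card_regular_kernel ntZ transH regH) cardH subn1 prednK.
have cardGe : #|G| = (e ^ 3 * (e - 1))%N by rewrite cardG mulnBr muln1 -expnSr.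
have p'e : p^'.-nat (e - 1).
  by rewrite -cardH.
have p_e : p.-nat e by rewrite def_e pnatX pnat_id.
have cardP : #|P| = (e ^ 3)%N.
  rewrite (card_Hall sylP) cardGe partnM ?expn_gt0 ?e_gt0 ?subn_gt0 //.
  by rewrite (part_p'nat p'e) muln1 part_pnat_id // pnatX p_e.
have coPH : coprime #|P| #|H| by rewrite (pnat_coprime pP).
have defG : P * H = G.
  apply/eqP; rewrite eqEcard mul_subG //= TI_cardMg ?coprime_TIg //.
  by rewrite cardP cardH cardGe.
have iGP : #|G : P| = (e - 1)%N by rewrite -divgS // cardGe cardP mulKn ?expn_gt0 ?e_gt0.
have nPH : H \subset 'N(P) := subset_trans sHG (normal_norm nsPG).
have solH : solvable H.
  have pZ := pgroupS (center_sub P) pP.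
  have abelZ := transitive_pgroup_abelem p_pr pZ (center_abelian P) transH.
  have freeZ := semiregular_free_ring_action abelZ ntZ nPH regH.
  have [oddH|evenH] := boolP (odd #|H|).
    exact: free_ring_odd_solvable freeZ _ (subxx H) oddH.
  have H2 : 2 %| #|H| by rewrite dvdn2.
  have [t [Ct ntt t2 uniq_t]] := free_ring_central_involution freeZ (subxx H) H2.
  have [Ht /centP cHt] := setIP Ct.
  have oddP : odd #|P|.
    rewrite cardP oddX /=; move: evenH; rewrite cardH oddB //= addbT negbK.
    by [].
  have regt : 'C_('Z(P))[t] = 1 by apply: regH; rewrite !inE ntt.
  have camP g z := @camina_center _ G P e nsPG cardP cardZ e_gt1 iGP i chi1 g z.
  have leTI (C : {group gT}) := @card_TI_center_leq _ G P e nsPG cardP cardZ e_gt1 iGP i chi1 C.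
  have nPt := subsetP nPH t Ht.
  have [cardC abC CPz CPi [y Py inj]] :=
    involution_centraliser_spread oddP nPt t2 regt cardP cardZ e_gt1 camP leTI.
  have sCP : 'C_P[t] \subset P := subsetIl _ _.
  have ntC : 'C_P[t]%G :!=: 1 by rewrite -cardG_gt1 cardC.
  have abelC : p.-abelem 'C_P[t]%G.
    (* Since [[~ c ^+ p, y] = [~ c, y] ^+ p = 1], injectivity of commutation with [y] gives
       [c ^+ p = 1]. *)
    rewrite abelemE // abC; apply/exponentP => c Cc; apply: inj => //.
      exact: groupX.
    have cc : commute c [~ c, y].
      by case/setIP: (CPz c y Cc Py) => _ /centP cz; apply/commute_sym/cz/(subsetP sCP).
    by rewrite commXg //; have [_ ->] := abelemP p_pr abelZ; rewrite // CPz.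
  apply: (commutator_spread_solvable abelZ ntZ abelC ntC _ nPH _ regH _ sCP) => //.
  - by rewrite cardC cardZ.
  - apply: (normsI nPH); apply: subset_trans (normG _).
    by apply/subsetP => h Hh; apply/cent1P/commute_sym/cHt.
  - move=> u Hu u2; have [->|ntu] := eqVneq u 1; first exact: group1.
    rewrite (uniq_t u) //; apply/centP => c /setIP[_ /cent1P].
    by [].
  by exists y.
rewrite (series_sol nsPG) (pgroup_sol pP) -defG quotientMidl.
exact: quotient_sol.
Qed.

Unset Implicit Arguments.

Theorem corollary3p2 (gT : finGroupType) (G P H : {group gT}) (p a e : nat)
  (p_prime : prime p) (a_ge1 : 1 <= a) (e_def : e = (p ^ a)%N)
  (isaacsG : isaacs_group e G)
  (sylP : p.-Sylow(G) P) (nsPG : P <| G)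
  (hallH : p^'.-Hall(G) H) (cardH : #|H| = (e - 1)%N)
  (frobZPH : two_transitive_frobenius ('Z(P) <*> H)%G 'Z(P)%G H) :
  (~~ solvable G <->
     two_transitive_frobenius ('Z(P) <*> H)%G 'Z(P)%G H /\
     ~~ solvable ('Z(P) <*> H))
  /\ (~~ solvable G ->
      e = (p ^ 2)%N /\
      [\/ p = 11 /\ H \isog 'SL_2(5),
          p = 29 /\ H \isog setX 'SL_2(5) (Zp 7)
        | p = 59 /\ H \isog setX 'SL_2(5) (Zp 29)]).
Proof.
(* As [G] and its subgroup ['Z(P) <*> H] are solvable, both sides of the equivalence are false and
   the final implication is vacuous. *)
have solG : solvable G.
  exact: (isaacs_pclosed_solvable p_prime e_def isaacsG sylP nsPG hallH cardH frobZPH).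
have sHG : H \subset G by case/andP: hallH.
have solZH : solvable ('Z(P) <*> H).
  apply: solvableS solG; rewrite join_subG sHG andbT.
  exact: subset_trans (center_sub P) (normal_sub nsPG).
by rewrite solG; split=> //; split=> // -[_]; rewrite solZH.
Qed.
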